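(* Let $n\ge 2$, let $S=\{s_i:1\le i\le n-1\}$, and let $\Phi:(S\cup\{e,t\})^*\to\mathcal P_n$ be the monoid homomorphism determined by $e\Phi=\overline e$, $t\Phi=\overline t$ and $s_i\Phi=\overline s_i$ for each $i$. Then the monoid $\mathcal P_n$ has monoid presentation $\langle S\cup\{e,t\}:R\rangle$ via $\Phi$ (that is, $\Phi$ is surjective and its kernel is the congruence on $(S\cup\{e,t\})^*$ generated by $R$), where $R$ consists of the following relations (those in which all letters $s_i$ that occur have $1\le i\le n-1$): \begin{itemize} \item[(R11)] $s_i^2=1$ for all $i$; \item[(R12)] $s_is_j=s_js_i$ if $|i-j|>1$; \item[(R13)] $s_is_js_i=s_js_is_j$ if $|i-j|=1$; \item[(R14)] $e^2=e=ete$; \item[(R15)] $t^2=t=tet=ts_1=s_1t$; \item[(R16)] $es_i=s_ie$ if $i\ge2$; \item[(R17)] $ts_i=s_it$ if $i\ge3$; \item[(R18)] $s_1es_1e=es_1es_1=es_1e$; \item[(R19)] $ts_2ts_2=s_2ts_2t$; \item[(R20)] $t(s_2s_3s_1s_2)t(s_2s_3s_1s_2)=(s_2s_3s_1s_2)t(s_2s_3s_1s_2)t$; \item[(R21)] $t(s_2s_1es_1s_2)=(s_2s_1es_1s_2)t$. \end{itemize}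
   Context: Write $\mathbf n=\{1,\dots,n\}$ and $\mathbf n'=\{1',\dots,n'\}$. The partition monoid $\mathcal P_n$ is the set of all set partitions of $\mathbf n\cup\mathbf n'$ with the following product. For $\alpha,\beta\in\mathcal P_n$, take a third copy $\mathbf n''=\{1'',\dots,n''\}$ of $\mathbf n$, replace each $x'$ by $x''$ in $\alpha$, and replace each $x$ by $x''$ in $\beta$ (for $x\in\mathbf n$). Form the finest equivalence relation on $\mathbf n\cup\mathbf n''\cup\mathbf n'$ under which any two elements in a common block of the modified $\alpha$ or in a common block of the modified $\beta$ are equivalent. Then $\alpha\beta$ is the partition of $\mathbf n\cup\mathbf n'$ obtained by restricting this equivalence to $\mathbf n\cup\mathbf n'$. The identity is the partition with blocks $\{x,x'\}$, $x\in\mathbf n$. The partition $\overline e$ has blocks $\{1\}$, $\{1'\}$ and $\{x,x'\}$ for $x\ge2$. The partition $\overline t$ has blocks $\{1,2,1',2'\}$ and $\{x,x'\}$ for $x\ge3$. For $1\le i\le n-1$, the partition $\overline s_i$ has blocks $\{i,(i+1)'\}$, $\{i+1,i'\}$ and $\{x,x'\}$ for $x\notin\{i,i+1\}$. $X^*$ denotes the free monoid on an alphabet $X$, and $1$ denotes the empty word. The kernel of a homomorphism is the congruence consisting of pairs with equal image. Maps are written on the right. *)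

(* Defs.v *)
From HB Require Import structures.
From mathcomp Require Import all_boot.

Set Implicit Arguments.
Unset Strict Implicit.
Unset Printing Implicit Defensive.

(* Partitions of n \cup n'.  The element x of {1, .., n} is the ordinal of
   value x - 1; [inl] is the unprimed copy and [inr] the primed one. *)

Definition vertex (n : nat) : finType := ('I_n + 'I_n)%type.

Record partition_monoid (n : nat) := PartitionMonoid {
  blocks :> {set {set vertex n}};
  blocksP : partition blocks [set: vertex n]
}.

HB.instance Definition _ n := [isSub for @blocks n].
HB.instance Definition _ n := [Finite of partition_monoid n by <:].

(* [inl] embeds n \cup n' and [inr] is the third copy n''. *)

Definition vertex3 (n : nat) : finType := (vertex n + 'I_n)%type.

(* x' becomes x'' *)
Definition primed_to_third n (v : vertex n) : vertex3 n :=
  match v with inl x => inl (inl x) | inr x => inr x end.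

(* x becomes x'' *)
Definition unprimed_to_third n (v : vertex n) : vertex3 n :=
  match v with inl x => inr x | inr x => inl (inr x) end.

Definition common_block n (a b : partition_monoid n) : rel (vertex3 n) :=
  fun w z =>
    [exists A in blocks a, (w \in @primed_to_third n @: A)
                           && (z \in @primed_to_third n @: A)]
 || [exists B in blocks b, (w \in @unprimed_to_third n @: B)
                           && (z \in @unprimed_to_third n @: B)].

(* [connect] is the reflexive transitive closure; as [common_block] is
   symmetric this is the finest equivalence containing it, see
   [join_equivalence] and [join_finest]. *)
Definition join n (a b : partition_monoid n) : rel (vertex3 n) :=
  connect (common_block a b).

Lemma common_block_sym n (a b : partition_monoid n) :
  symmetric (common_block a b).
Proof.
by move=> w z; rewrite /common_block; congr (_ || _);
   apply: eq_existsb => A; congr (_ && _); rewrite andbC.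
Qed.

Lemma join_equivalence n (a b : partition_monoid n) :
  equivalence_rel (join a b).
Proof.
apply/equivalence_relP; split; first exact: connect0.
move=> w z wz u.
exact: (same_connect (sym_connect_sym (common_block_sym a b)) wz).
Qed.

Lemma join_finest n (a b : partition_monoid n) (r : rel (vertex3 n)) :
  equivalence_rel r -> subrel (common_block a b) r -> subrel (join a b) r.
Proof.
move=> /equivalence_relP[rxx rlt] sub w z /connectP[p].
elim: p w => [|y p IHp] w /=; first by move=> _ ->.
by case/andP=> wy yp /(IHp _ yp) yz; rewrite (rlt _ _ (sub _ _ wy)).
Qed.

Definition mul_blocks n (a b : partition_monoid n) : {set {set vertex n}} :=
  equivalence_partition (fun u v => join a b (inl u) (inl v)) [set: vertex n].

Lemma mul_blocksP n (a b : partition_monoid n) :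
  partition (mul_blocks a b) [set: vertex n].
Proof.
by apply: equivalence_partitionP => u v w _ _ _; apply: join_equivalence.
Qed.

Definition mul_partition n (a b : partition_monoid n) : partition_monoid n :=
  PartitionMonoid (mul_blocksP a b).

Lemma explicit_partition n (B : {set {set vertex n}})
    (c : vertex n -> {set vertex n}) :
    set0 \notin B -> (forall v, c v \in B) -> (forall v, v \in c v) ->
    (forall A v, A \in B -> v \in A -> A = c v) ->
  partition B [set: vertex n].
Proof.
move=> B0 cB cv cE; apply/and3P; split=> //.
  apply/eqP/setP=> v; rewrite inE.
  by apply/bigcupP; exists (c v).
apply/trivIsetP=> A A' BA BA'; apply: contraR.
by case/pred0Pn=> v /andP[/= vA vA']; rewrite (cE _ _ BA vA) (cE _ _ BA' vA').
Qed.

(* {x, x'} *)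
Definition through n (x : 'I_n) : {set vertex n} := [set inl x; inr x].

Definition one_blocks n : {set {set vertex n}} :=
  [set through x | x : 'I_n].

Lemma through0 n (x : 'I_n) : set0 != through x.
Proof. by apply/eqP/setP => /(_ (inl x)); rewrite !inE eqxx. Qed.

Definition under n (v : vertex n) : 'I_n :=
  match v with inl x => x | inr x => x end.

Lemma in_through n (x : 'I_n) v : (v \in through x) = (under v == x).
Proof. by case: v => y; rewrite !inE /eq_op /= ?orbF. Qed.

Lemma one_blocksP n : partition (one_blocks n) [set: vertex n].
Proof.
apply: (explicit_partition (c := fun v => through (under v))).
- by apply/imsetP=> -[x _ /eqP]; rewrite (negPf (through0 x)).
- by move=> v; apply: imset_f.
- by move=> v; rewrite in_through.
- by move=> _ v /imsetP[x _ ->]; rewrite in_through => /eqP->.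
Qed.

Definition one_partition n : partition_monoid n :=
  PartitionMonoid (one_blocksP n).

Section MonoidLaws.
Variable n : nat.
Implicit Types a b c : partition_monoid n.

Let same a (u v : vertex n) : bool := v \in pblock a u.

Let sameP a u v : reflect (exists2 A, A \in blocks a & (u \in A) && (v \in A))
                          (same a u v).
Proof.
have /and3P[/eqP cov tri _] := blocksP a.
apply: (iffP idP) => [uv | [A aA /andP[uA vA]]].
  have uT : u \in cover a by rewrite cov inE.
  by exists (pblock a u); [exact: pblock_mem | rewrite mem_pblock uT].
by rewrite /same (def_pblock tri aA uA).
Qed.

Let same_refl a u : same a u u.
Proof. by have /and3P[/eqP cov _ _] := blocksP a; rewrite /same mem_pblock cov. Qed.

Let same_sym a u v : same a u v -> same a v u.
Proof. by case/sameP=> A aA uv; apply/sameP; exists A => //; rewrite andbC. Qed.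

Let same_ext a b : (forall u v, same a u v = same b u v) -> a = b.
Proof.
move=> ab; apply: val_inj => /=.
rewrite -(equivalence_partition_pblock (blocksP a)).
rewrite -(equivalence_partition_pblock (blocksP b)).
by apply: eq_imset => u; apply/setP=> v; rewrite !inE; apply: ab.
Qed.

Let same_mul a b u v :
  same (mul_partition a b) u v = join a b (inl u) (inl v).
Proof.
rewrite /same pblock_equivalence_partition ?inE // => x y z _ _ _.
exact: join_equivalence.
Qed.

Let cbP a b w z : reflect
  ((exists u v, [/\ w = primed_to_third u, z = primed_to_third v & same a u v])
   \/ (exists u v,
        [/\ w = unprimed_to_third u, z = unprimed_to_third v & same b u v]))
  (common_block a b w z).
Proof.
apply: (iffP orP) => -[].
- case/exists_inP=> A aA /andP[/imsetP[u uA ->] /imsetP[v vA ->]].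
  by left; exists u, v; split=> //; apply/sameP; exists A; rewrite ?uA.
- case/exists_inP=> A aA /andP[/imsetP[u uA ->] /imsetP[v vA ->]].
  by right; exists u, v; split=> //; apply/sameP; exists A; rewrite ?uA.
- case=> u [v [-> -> /sameP[A aA /andP[uA vA]]]].
  by left; apply/exists_inP; exists A; rewrite ?imset_f.
- case=> u [v [-> -> /sameP[A aA /andP[uA vA]]]].
  by right; apply/exists_inP; exists A; rewrite ?imset_f.
Qed.

Let join_ind a b (P : vertex3 n -> Prop) :
    (forall u v, same a u v -> P (primed_to_third u) -> P (primed_to_third v)) ->
    (forall u v, same b u v ->
       P (unprimed_to_third u) -> P (unprimed_to_third v)) ->
  forall w z, join a b w z -> P w -> P z.
Proof.
move=> Pa Pb w z /connectP[p]; elim: p w => [|y p IHp] w /=; first by move=> _ ->.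
case/andP=> wy yp /(IHp _ yp) IH Pw; apply: IH.
by case/cbP: wy Pw => -[u [v [-> -> uv]]]; [apply: Pa | apply: Pb].
Qed.

Let join_l a b u v : same a u v ->
  join a b (primed_to_third u) (primed_to_third v).
Proof. by move=> uv; apply/connect1/cbP; left; exists u, v. Qed.

Let join_r a b u v : same b u v ->
  join a b (unprimed_to_third u) (unprimed_to_third v).
Proof. by move=> uv; apply/connect1/cbP; right; exists u, v. Qed.

Let join_trans a b : transitive (join a b).
Proof. exact: connect_trans. Qed.

Let join_sym a b w z : join a b w z -> join a b z w.
Proof. by rewrite /join (sym_connect_sym (common_block_sym a b)). Qed.

Let vertex4 : Type := (vertex n + vertex n)%type.

Let first (v : vertex n) : vertex4 :=
  match v with inl x => inl (inl x) | inr x => inr (inl x) end.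
Let second (v : vertex n) : vertex4 := inr v.
Let third (v : vertex n) : vertex4 :=
  match v with inl x => inr (inr x) | inr x => inl (inr x) end.

Let join3 a b c (y z : vertex4) : Prop := forall P : vertex4 -> Prop,
  (forall u v, same a u v -> P (first u) -> P (first v)) ->
  (forall u v, same b u v -> P (second u) -> P (second v)) ->
  (forall u v, same c u v -> P (third u) -> P (third v)) -> P y -> P z.

Let mul_join3l a b c u v :
  join (mul_partition a b) c (inl u) (inl v) <-> join3 a b c (inl u) (inl v).
Proof.
split=> [uv P Pa Pb Pc | uv].
  pose f (w : vertex3 n) : vertex4 :=
    match w with inl v => inl v | inr x => inr (inr x) end.
  pose g (w : vertex3 n) : vertex4 :=
    match w with inl (inl x) => inl (inl x) | inl (inr x) => inr (inr x)
    | inr x => inr (inl x) end.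
  apply: (join_ind (P := fun w => P (f w)) _ _ uv) => [x y | x y xy].
    rewrite same_mul => xy.
    have E z : f (primed_to_third z) = g (inl z) by case: z.
    rewrite !E; apply: (join_ind (P := fun w => P (g w)) _ _ xy).
      by move=> [s|s] [t|t]; apply: Pa.
    by move=> [s|s] [t|t]; apply: Pb.
  by case: x y xy => [s|s] [t|t]; apply: Pc.
pose D w := join (mul_partition a b) c (inl u) w.
pose Q w := exists2 z, D (primed_to_third z) & join a b (inl z) w.
have DQ z : Q (inl z) <-> D (primed_to_third z).
  split=> [[y Dy yz] | Dz]; last by exists z => //; apply: connect0.
  by apply: join_trans Dy _; apply: join_l; rewrite same_mul.
have QT w z : join a b w z -> Q w -> Q z.
  by move=> wz [y Dy yw]; exists y => //; apply: join_trans yw wz.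
pose P (y : vertex4) : Prop :=
  match y with
  | inl (inl x) => Q (inl (inl x))
  | inl (inr x) => D (inl (inr x))
  | inr (inl x) => Q (inr x)
  | inr (inr x) => Q (inl (inr x)) end.
have PD z : P (inl z) <-> D (inl z) by case: z => z //=; apply: DQ.
apply/PD; apply: (uv P); last by apply/PD; apply: connect0.
- have E z : P (first z) = Q (primed_to_third z) by case: z.
  by move=> x y xy; rewrite !E; apply/QT/join_l.
- have E z : P (second z) = Q (unprimed_to_third z) by case: z.
  by move=> x y xy; rewrite !E; apply/QT/join_r.
- have E z : P (third z) <-> D (unprimed_to_third z).
    by case: z => z //=; apply: DQ.
  move=> x y xy /E Dx; apply/E; apply: join_trans Dx _.
  exact: join_r.
Qed.

Let mul_join3r a b c u v :
  join a (mul_partition b c) (inl u) (inl v) <-> join3 a b c (inl u) (inl v).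
Proof.
split=> [uv P Pa Pb Pc | uv].
  pose f (w : vertex3 n) : vertex4 :=
    match w with inl v => inl v | inr x => inr (inl x) end.
  pose g (w : vertex3 n) : vertex4 :=
    match w with inl (inl x) => inr (inl x) | inl (inr x) => inl (inr x)
    | inr x => inr (inr x) end.
  apply: (join_ind (P := fun w => P (f w)) _ _ uv) => [x y xy | x y].
    by case: x y xy => [s|s] [t|t]; apply: Pa.
  rewrite same_mul => xy.
  have E z : f (unprimed_to_third z) = g (inl z) by case: z.
  rewrite !E; apply: (join_ind (P := fun w => P (g w)) _ _ xy).
    by move=> [s|s] [t|t]; apply: Pb.
  by move=> [s|s] [t|t]; apply: Pc.
pose D w := join a (mul_partition b c) (inl u) w.
pose Q w := exists2 z, D (unprimed_to_third z) & join b c (inl z) w.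
have DQ z : Q (inl z) <-> D (unprimed_to_third z).
  split=> [[y Dy yz] | Dz]; last by exists z => //; apply: connect0.
  by apply: join_trans Dy _; apply: join_r; rewrite same_mul.
have QT w z : join b c w z -> Q w -> Q z.
  by move=> wz [y Dy yw]; exists y => //; apply: join_trans yw wz.
pose P (y : vertex4) : Prop :=
  match y with
  | inl (inl x) => D (inl (inl x))
  | inl (inr x) => Q (inl (inr x))
  | inr (inl x) => Q (inl (inl x))
  | inr (inr x) => Q (inr x) end.
have PD z : P (inl z) <-> D (inl z) by case: z => z //=; apply: DQ.
apply/PD; apply: (uv P); last by apply/PD; apply: connect0.
- have E z : P (first z) <-> D (primed_to_third z).
    by case: z => z //=; apply: DQ.
  move=> x y xy /E Dx; apply/E; apply: join_trans Dx _.
  exact: join_l.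
- have E z : P (second z) = Q (primed_to_third z) by case: z.
  by move=> x y xy; rewrite !E; apply/QT/join_l.
- have E z : P (third z) = Q (unprimed_to_third z) by case: z.
  by move=> x y xy; rewrite !E; apply/QT/join_r.
Qed.

Lemma mul_partitionA : associative (@mul_partition n).
Proof.
move=> a b c; apply: same_ext => u v; rewrite !same_mul.
by apply/idP/idP => [/mul_join3r/mul_join3l | /mul_join3l/mul_join3r].
Qed.

Let same_one u v : same (one_partition n) u v = (under u == under v).
Proof.
apply/sameP/eqP => [[_ /imsetP[x _ ->]]|E].
  by rewrite !in_through => /andP[/eqP-> /eqP->].
by exists (through (under u)); rewrite ?imset_f // !in_through E eqxx.
Qed.

Lemma mul1_partition : left_id (one_partition n) (@mul_partition n).
Proof.
move=> a; apply: same_ext => u v; rewrite same_mul.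
have E z : join (one_partition n) a (inl z) (unprimed_to_third z).
  case: z => x; last exact: connect0.
  by apply: (@join_l _ _ (inl x) (inr x)); rewrite same_one.
apply/idP/idP => [uv | uv]; last first.
  apply: join_trans (E u) (join_trans (join_r _ uv) _).
  exact/join_sym/E.
pose P (w : vertex3 n) :=
  match w with inl v => same a u v | inr x => same a u (inl x) end.
apply: (join_ind (P := P) _ _ uv); last exact: same_refl.
  by move=> [x|x] [y|y]; rewrite same_one => /eqP /= ->.
have EP z : P (unprimed_to_third z) = same a u z by case: z.
move=> x y; rewrite !EP => /sameP[A aA /andP[xA yA]].
have /and3P[_ tri _] := blocksP a.
case/sameP=> B aB /andP[uB xB]; apply/sameP; exists B => //.
by rewrite uB -(def_pblock tri aB xB) (def_pblock tri aA xA).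
Qed.

Lemma mulp1_partition : right_id (one_partition n) (@mul_partition n).
Proof.
move=> a; apply: same_ext => u v; rewrite same_mul.
have E z : join a (one_partition n) (inl z) (primed_to_third z).
  case: z => x; first exact: connect0.
  by apply: (@join_r _ _ (inr x) (inl x)); rewrite same_one.
apply/idP/idP => [uv | uv]; last first.
  apply: join_trans (E u) (join_trans (join_l _ uv) _).
  exact/join_sym/E.
pose P (w : vertex3 n) :=
  match w with inl v => same a u v | inr x => same a u (inr x) end.
apply: (join_ind (P := P) _ _ uv); last exact: same_refl.
  have EP z : P (primed_to_third z) = same a u z by case: z.
  move=> x y; rewrite !EP => /sameP[A aA /andP[xA yA]].
  have /and3P[_ tri _] := blocksP a.
  case/sameP=> B aB /andP[uB xB]; apply/sameP; exists B => //.
  by rewrite uB -(def_pblock tri aB xB) (def_pblock tri aA xA).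
by move=> [x|x] [y|y]; rewrite same_one => /eqP /= ->.
Qed.

End MonoidLaws.

HB.instance Definition _ n := isMonoid.Build (partition_monoid n)
  (@mul_partitionA n) (@mul1_partition n) (@mulp1_partition n).

Definition point1 n (hn : 1 < n) : 'I_n := Ordinal (ltnW hn).
Definition point2 n (hn : 1 < n) : 'I_n := Ordinal hn.

Definition e_blocks n (hn : 1 < n) : {set {set vertex n}} :=
  [set inl (point1 hn)] |: ([set inr (point1 hn)] |:
  [set through x | x : 'I_n & x != point1 hn]).

Lemma e_blocksP n (hn : 1 < n) : partition (e_blocks hn) [set: vertex n].
Proof.
apply: (explicit_partition (c := fun v : vertex n =>
  if under v == point1 hn then [set v] else through (under v))).
- rewrite !inE !negb_or; apply/and3P; split.
  + by apply/eqP/setP=> /(_ (inl (point1 hn))); rewrite !inE eqxx.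
  + by apply/eqP/setP=> /(_ (inr (point1 hn))); rewrite !inE eqxx.
  + by apply/imsetP=> -[x _ /eqP]; rewrite (negPf (through0 x)).
- move=> v; case: ifPn => [/eqP|] Ev.
    by case: v Ev => x /= ->; rewrite !inE eqxx ?orbT.
  by rewrite !inE imset_f ?orbT // inE.
- by move=> v; case: ifP => _; [rewrite inE | rewrite in_through].
- move=> A v /setU1P[->|/setU1P[->|/imsetP[x + ->]]].
  + by move/set1P->; rewrite /= ?eqxx.
  + by move/set1P->; rewrite /= ?eqxx.
  + by rewrite inE in_through => nx /eqP->; rewrite (negPf nx).
Qed.

Definition e_bar n (hn : 1 < n) : partition_monoid n :=
  PartitionMonoid (e_blocksP hn).

Definition t_blocks n (hn : 1 < n) : {set {set vertex n}} :=
  [set inl (point1 hn); inl (point2 hn); inr (point1 hn); inr (point2 hn)]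
  |: [set through x | x : 'I_n & x \notin [:: point1 hn; point2 hn]].

Lemma t_blocksP n (hn : 1 < n) : partition (t_blocks hn) [set: vertex n].
Proof.
set T := [set inl (point1 hn); inl (point2 hn); inr (point1 hn);
              inr (point2 hn)].
have inT v : (v \in T) = (under v \in [:: point1 hn; point2 hn]).
  by case: v => x; rewrite !inE /eq_op /= ?orbF.
apply: (explicit_partition (c := fun v : vertex n =>
  if under v \in [:: point1 hn; point2 hn] then T else through (under v))).
- rewrite in_setU1 negb_or; apply/andP; split.
  + by apply/eqP/setP=> /(_ (inl (point1 hn))); rewrite !inE eqxx.
  + by apply/imsetP=> -[x _ /eqP]; rewrite (negPf (through0 x)).
- move=> v; case: ifPn => Ev; first exact: setU11.
  by rewrite in_setU1 imset_f ?orbT // inE.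
- by move=> v; case: ifP => Ev; [rewrite inT | rewrite in_through].
- move=> A v /setU1P[->|/imsetP[x + ->]]; first by rewrite inT => ->.
  by rewrite inE in_through => nx /eqP->; rewrite (negPf nx).
Qed.

Definition t_bar n (hn : 1 < n) : partition_monoid n :=
  PartitionMonoid (t_blocksP hn).

(* Indices are 1-based, unlike the ordinals. *)
Definition index_s (n : nat) := {i : nat | 0 < i < n}.

Lemma index_s_pred n (i : index_s n) : (val i).-1 < n.
Proof. by case: i => -[|i] //= /ltnW. Qed.

Lemma index_s_lt n (i : index_s n) : val i < n.
Proof. by case: i => i /= /andP[]. Qed.

(* the points i and i+1 *)
Definition point_i n (i : index_s n) : 'I_n := Ordinal (index_s_pred i).
Definition point_iS n (i : index_s n) : 'I_n := Ordinal (index_s_lt i).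

Definition s_blocks n (i : index_s n) : {set {set vertex n}} :=
  [set inl (point_i i); inr (point_iS i)]
  |: ([set inl (point_iS i); inr (point_i i)]
  |: [set through x | x : 'I_n & x \notin [:: point_i i; point_iS i]]).

Lemma s_blocksP n (i : index_s n) : partition (s_blocks i) [set: vertex n].
Proof.
rewrite /s_blocks; set p := point_i i; set q := point_iS i.
have pq : (p == q) = false.
  by rewrite -val_eqE /= /p /q /=; case: i {p q} => -[|i] //= _; rewrite ltn_eqF.
have qp : (q == p) = false by rewrite eq_sym.
clearbody p q.
apply: (explicit_partition (c := fun v : vertex n =>
  if v \in [set inl p; inr q] then [set inl p; inr q]
  else if v \in [set inl q; inr p] then [set inl q; inr p]
  else through (under v))).
- rewrite !inE !negb_or; apply/and3P; split.
  + by apply/eqP/setP=> /(_ (inl p)); rewrite !inE eqxx.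
  + by apply/eqP/setP=> /(_ (inl q)); rewrite !inE eqxx.
  + by apply/imsetP=> -[x _ /eqP]; rewrite (negPf (through0 x)).
- move=> v; case: ifPn => vp; first exact: setU11.
  case: ifPn => vq; first by rewrite setU1r ?setU11.
  rewrite !setU1r // imset_f // inE.
  by case: v vp vq => x; rewrite !inE /eq_op /= ?orbF => xp xq; apply/norP.
- by move=> v; case: ifP => // _; case: ifP => // _; rewrite in_through.
- move=> A v; rewrite in_setU1 => /predU1P[->|]; first by move=> ->.
  rewrite in_setU1 => /predU1P[->|/imsetP[x + ->]].
    by case/set2P=> ->; rewrite !inE /eq_op /= ?pq ?qp !eqxx ?orbT.
  rewrite inE in_through => nx /eqP E.
  move: nx; rewrite !inE negb_or => /andP[/negPf xp /negPf xq].
  by case: v E => y /= ->; rewrite !ifF // /eq_op /= orbF.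
Qed.

Definition s_bar n (i : index_s n) : partition_monoid n :=
  PartitionMonoid (s_blocksP i).

(* The free monoid on X is [seq X] with concatenation; [free_hom f] is the
   homomorphism from it determined by f. *)
Definition free_hom (M : monoidType) (X : Type) (f : X -> M) (w : seq X) : M :=
  (\prod_(x <- w) f x)%g.

Lemma free_hom_nil (M : monoidType) (X : Type) (f : X -> M) :
  free_hom f [::] = 1%g.
Proof. exact: big_nil. Qed.

Lemma free_hom_cat (M : monoidType) (X : Type) (f : X -> M) (u v : seq X) :
  free_hom f (u ++ v) = (free_hom f u * free_hom f v)%g.
Proof. exact: big_cat. Qed.

Lemma free_hom_letter (M : monoidType) (X : Type) (f : X -> M) (x : X) :
  free_hom f [:: x] = f x.
Proof. exact: big_seq1. Qed.

Inductive cong_gen (X : Type) (R : seq X -> seq X -> Prop) :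
    seq X -> seq X -> Prop :=
| cong_rel u v : R u v -> cong_gen R u v
| cong_refl u : cong_gen R u u
| cong_sym u v : cong_gen R u v -> cong_gen R v u
| cong_trans u v w : cong_gen R u v -> cong_gen R v w -> cong_gen R u w
| cong_cat u u' v v' :
    cong_gen R u u' -> cong_gen R v v' -> cong_gen R (u ++ v) (u' ++ v').

Definition has_presentation_via (M : monoidType) (X : Type)
    (R : seq X -> seq X -> Prop) (phi : seq X -> M) : Prop :=
  (forall m : M, exists w : seq X, phi w = m) /\
  (forall u v : seq X, phi u = phi v <-> cong_gen R u v).

Inductive letter (n : nat) : Type :=
| Ls of index_s n
| Le
| Lt.

Arguments Le {n}.
Arguments Lt {n}.

Definition gen_bar n (hn : 1 < n) (x : letter n) : partition_monoid n :=
  match x with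
  | Ls i => s_bar i
  | Le => e_bar hn
  | Lt => t_bar hn
  end.

Definition Phi n (hn : 1 < n) : seq (letter n) -> partition_monoid n :=
  free_hom (gen_bar hn).

(* A chain of equalities contributes one pair per equality sign. A relation
   mentioning s_k is quantified over the indices i of value k, hence is present
   exactly when k <= n - 1. *)
Inductive R n : seq (letter n) -> seq (letter n) -> Prop :=
| R11 i : R [:: Ls i; Ls i] [::]
| R12 i j : ((val i).+1 < val j) || ((val j).+1 < val i) ->
    R [:: Ls i; Ls j] [:: Ls j; Ls i]
| R13 i j : (val j == (val i).+1) || (val i == (val j).+1) ->
    R [:: Ls i; Ls j; Ls i] [:: Ls j; Ls i; Ls j]
| R14a : R [:: Le; Le] [:: Le]
| R14b : R [:: Le] [:: Le; Lt; Le]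
| R15a : R [:: Lt; Lt] [:: Lt]
| R15b : R [:: Lt] [:: Lt; Le; Lt]
| R15c s1 : val s1 = 1 -> R [:: Lt; Le; Lt] [:: Lt; Ls s1]
| R15d s1 : val s1 = 1 -> R [:: Lt; Ls s1] [:: Ls s1; Lt]
| R16 i : 2 <= val i -> R [:: Le; Ls i] [:: Ls i; Le]
| R17 i : 3 <= val i -> R [:: Lt; Ls i] [:: Ls i; Lt]
| R18a s1 : val s1 = 1 ->
    R [:: Ls s1; Le; Ls s1; Le] [:: Le; Ls s1; Le; Ls s1]
| R18b s1 : val s1 = 1 ->
    R [:: Le; Ls s1; Le; Ls s1] [:: Le; Ls s1; Le]
| R19 s2 : val s2 = 2 ->
    R [:: Lt; Ls s2; Lt; Ls s2] [:: Ls s2; Lt; Ls s2; Lt]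
| R20 s1 s2 s3 : val s1 = 1 -> val s2 = 2 -> val s3 = 3 ->
    let w := [:: Ls s2; Ls s3; Ls s1; Ls s2] in
    R (Lt :: w ++ Lt :: w) (w ++ Lt :: w ++ [:: Lt])
| R21 s1 s2 : val s1 = 1 -> val s2 = 2 ->
    let w := [:: Ls s2; Ls s1; Le; Ls s1; Ls s2] in
    R (Lt :: w) (w ++ [:: Lt]).

(* Main.v *)
Require Import Defs.
From Stdlib Require Import Setoid Morphisms.
From mathcomp Require Import all_boot all_fingroup zify.

Set Implicit Arguments.
Unset Strict Implicit.
Unset Printing Implicit Defensive.

Import GroupScope.
Local Open Scope nat_scope.

(** Modulo the Coxeter relations the words in the [s_i] are the permutations
    ([coxeter], by coset descent); let [W s] be a word for [s].  Since [e]
    commutes with [s_i] for [i >= 2] and [t] for [i >= 3], the conjugate of [e]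
    by [W s] depends only on the image [x] of point 1, and that of [t] only on
    the images [x], [y] of points 1 and 2.  These conjugates are written
    [cut x] (isolate [x] and [x']) and [merge x y] (join the lines of [x] and
    [y]).  The other relations, conjugated by permutations, become identities
    at arbitrary points: cuts commute, merges commute, [merge x y] and [cut z]
    commute for [z] off [x], [y], a merge absorbs the transposition of its
    points, as does a product of two cuts, and for distinct [x], [y] one has
    [cut x . merge x y . cut x = cut x] and
    [merge x y . cut x . merge x y = merge x y].

    These identities bring every word to the form
    [merges L . cuts A . W s . merges K] ([nf_word]): multiplying such a product
    on the right by a letter gives a product of the same shape.  Here
    [merges L] only depends on the equivalence that [L] generates, [cuts A] on
    the set [A], and [cuts A . W s] on the restriction of [s] to the complement
    of [A].  One may further arrange that the points [x] outside [A], and their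
    images [s x], are chosen representatives of their [L]-class and [K]-class
    ([nf_normal]).

    A partition then determines its normal form.  Let a partition relate two
    colourings [f], [g] of the points by two colours when [f] on the unprimed
    and [g] on the primed points together are constant on blocks.  Products
    become composites of relations ([compatibleM]), different partitions give
    different relations ([compatible_inj]), and a letter acts so simply that the
    defining relations are checked directly ([R_sound]).  The relation of a
    normal form says: [f] is constant on [L]-classes, [g] on [K]-classes, and
    [f x = g (s x)] for [x] outside [A] ([run_nf]).  Colouring a single block
    shows that no further equalities are forced, so that the relation gives
    back both equivalences, [A], and [s] off [A] ([nf_unique]).  Conversely
    each partition is the one of such a product, built from its upper and lower
    kernels and a permutation extending the matching of its transversal blocks
    ([Phi_surjective]). *)

(** * Words modulo the relations *)

Definition cong n : seq (letter n) -> seq (letter n) -> Prop := cong_gen (@R n).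

Notation "u ≈ v" := (cong u v) (at level 70, no associativity).

#[global] Instance cong_equivalence n : Equivalence (@cong n).
Proof.
split; [exact: cong_refl | exact: cong_sym | exact: cong_trans].
Qed.

Lemma congxx n (u : seq (letter n)) : u ≈ u.
Proof. exact: cong_refl. Qed.
#[local] Hint Resolve congxx : core.

#[global] Instance cat_cong n :
  Proper (@cong n ==> @cong n ==> @cong n) (@cat (letter n)).
Proof. by move=> u u' uu' v v' vv'; apply: cong_cat. Qed.

(** * Partitions as relations between colourings *)

Section Colourings.
Variables (n : nat) (hn : 1 < n).
Implicit Types (a b : partition_monoid n) (x y : 'I_n).
Implicit Types (f g h : {ffun 'I_n -> bool}).

Local Notation p0 := (point1 hn).
Local Notation p1 := (point2 hn).

Definition glue f g (v : vertex n) : bool :=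
  match v with inl x => f x | inr x => g x end.

Definition compatible a f g : Prop :=
  forall A u v, A \in blocks a -> u \in A -> v \in A -> glue f g u = glue f g v.

Definition same a (u v : vertex n) : bool := v \in pblock a u.

Lemma same_refl a u : same a u u.
Proof.
by have /and3P[/eqP cov _ _] := blocksP a; rewrite /same mem_pblock cov.
Qed.

Lemma in_block a A u : A \in blocks a -> u \in A ->
  forall v, (v \in A) = same a u v.
Proof.
have /and3P[_ tri _] := blocksP a; move=> aA uA v.
by rewrite /same (def_pblock tri aA uA).
Qed.

Lemma block_mem a u : pblock a u \in blocks a.
Proof. by have /and3P[/eqP cov _ _] := blocksP a; rewrite pblock_mem ?cov. Qed.

Lemma same_sym a u v : same a u v = same a v u.
Proof.
by apply/idP/idP => uv; rewrite -(in_block (block_mem a _) uv);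
   apply: same_refl.
Qed.

Lemma same_trans a : transitive (same a).
Proof.
move=> v u w uv vw; rewrite -(in_block (block_mem a u) (same_refl a u)).
by rewrite (in_block (block_mem a u) uv).
Qed.

Lemma compatibleP a f g :
  compatible a f g <-> forall u v, same a u v -> glue f g u = glue f g v.
Proof.
split=> [fg u v uv | fg A u v aA uA vA];
  last by rewrite (fg u v) // -(in_block aA).
exact: (fg _ _ _ (block_mem a u) (same_refl a u) uv).
Qed.

Lemma same_mul a b u v : same (a * b)%g u v = join a b (inl u) (inl v).
Proof.
rewrite /same pblock_equivalence_partition ?inE // => x y z _ _ _.
exact: join_equivalence.
Qed.

Lemma same_eq a b : (forall u v, same a u v = same b u v) -> a = b.
Proof.
move=> ab; apply: val_inj => /=.
rewrite -(equivalence_partition_pblock (blocksP a)).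
rewrite -(equivalence_partition_pblock (blocksP b)).
by apply: eq_imset => u; apply/setP=> v; rewrite !inE; apply: ab.
Qed.

(** Colouring one block of [b] and nothing else detects every pair of vertices
    that [b] separates. *)
Lemma compatible_sub a b : (forall f g, compatible b f g -> compatible a f g) ->
  forall u v, same a u v -> same b u v.
Proof.
move=> ba u v uv.
pose f := [ffun x => same b u (inl x)]; pose g := [ffun x => same b u (inr x)].
have fgE w : glue f g w = same b u w by case: w => w; rewrite /= ffunE.
have /compatibleP/(_ u v uv) : compatible a f g.
  apply/ba/compatibleP=> w z wz; rewrite !fgE.
  by apply/idP/idP=> uw; apply: same_trans uw _; rewrite // same_sym.
by rewrite !fgE same_refl.
Qed.

Lemma compatible_inj a b :
  (forall f g, compatible a f g <-> compatible b f g) -> a = b.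
Proof.
move=> ab; apply: same_eq => u v.
by apply/idP/idP; apply: compatible_sub => f g /ab.
Qed.

Lemma compatible1 f g : compatible 1%g f g <-> f = g.
Proof.
split=> [fg|-> A u v /imsetP[x _ ->]].
  apply/ffunP=> x; apply: (fg (through x) (inl x) (inr x));
    rewrite ?inE ?eqxx ?orbT //.
  exact: imset_f.
by rewrite !in_through; case: u v => u [v|v] /= /eqP-> /eqP->.
Qed.

(** A colouring that is constant on the blocks of the product extends to the
    middle row: give a middle vertex the colour of the outer vertices joined to
    it, and a fixed colour if there are none. *)
Lemma compatibleM a b f h :
  compatible (a * b)%g f h <->
  exists2 g, compatible a f g & compatible b g h.
Proof.
split=> [fh | [g fg gh]].
  pose F w := [exists u, join a b (inl u) w && glue f h u].
  have FJ w z : join a b w z -> F w = F z.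
    move=> wz; apply: eq_existsb => u; congr (_ && _).
    exact: (same_connect_r (sym_connect_sym (common_block_sym a b)) wz).
  have Fl u : F (inl u) = glue f h u.
    apply/existsP/idP => [[v /andP[vu hv]] | hu]; last first.
      by exists u; rewrite /join connect0.
    have /compatibleP/(_ v u) <- // := fh.
    by rewrite same_mul.
  exists [ffun x => F (inr x)].
    move=> A u v aA uA vA.
    have E z : glue f [ffun x => F (inr x)] z = F (primed_to_third z).
      by case: z => z /=; rewrite ?ffunE ?Fl.
    rewrite !E; apply/FJ/connect1/orP; left.
    by apply/exists_inP; exists A; rewrite ?imset_f.
  move=> A u v aA uA vA.
  have E z : glue [ffun x => F (inr x)] h z = F (unprimed_to_third z).
    by case: z => z /=; rewrite ?ffunE ?Fl.
  rewrite !E; apply/FJ/connect1/orP; right.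
  by apply/exists_inP; exists A; rewrite ?imset_f.
pose F (w : vertex3 n) :=
  match w with inl u => glue f h u | inr x => g x end.
apply/compatibleP=> u v; rewrite same_mul.
have eqF : equivalence_rel (fun w z => F w == F z).
  by move=> x y z; split=> // /eqP->.
move/(join_finest eqF) => H; apply/eqP/H => w z.
case/orP=> /exists_inP[A aA] /andP[/imsetP[x xA ->] /imsetP[y yA ->]].
  have E t : F (primed_to_third t) = glue f g t by case: t.
  by rewrite !E; apply/eqP/(fg A).
have E t : F (unprimed_to_third t) = glue g h t by case: t.
by rewrite !E; apply/eqP/(gh A).
Qed.

Lemma compatible_e f g :
  compatible (e_bar hn) f g <-> forall x, x != p0 -> f x = g x.
Proof.
split=> [fg x xp0 | fg A u v].
  apply: (fg (through x) (inl x) (inr x)); rewrite ?in_through //.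
  by rewrite !inE imset_f ?orbT // inE.
case/setU1P=> [->|/setU1P[->|/imsetP[x + ->]]]; try by move=> /set1P-> /set1P->.
rewrite inE !in_through => /fg xp0.
by case: u v => u [v|v] /= /eqP-> /eqP->.
Qed.

Lemma compatible_t f g : compatible (t_bar hn) f g <-> f p0 = f p1 /\ f = g.
Proof.
split=> [fg | [f01 <-] A u v].
  pose T : {set vertex n} := [set inl p0; inl p1; inr p0; inr p1].
  have aT : T \in blocks (t_bar hn) by apply: setU11.
  split; first by apply: (fg T (inl p0) (inl p1)); rewrite ?inE ?eqxx ?orbT.
  apply/ffunP=> x; have [xT|xT] := boolP (x \in [:: p0; p1]).
    apply: (fg T (inl x) (inr x)) => //.
      by move: xT; rewrite !inE => /orP[]/eqP->; rewrite eqxx ?orbT.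
    by move: xT; rewrite !inE => /orP[]/eqP->; rewrite eqxx ?orbT.
  apply: (fg (through x) (inl x) (inr x)); rewrite ?in_through //.
  by rewrite in_setU1 imset_f ?orbT // inE.
have E w : glue f f w = f (under w) by case: w.
case/setU1P=> [->|/imsetP[x + ->]]; rewrite !E; last first.
  by rewrite !in_through => _ /eqP-> /eqP->.
suff T w : w \in [set inl p0; inl p1; inr p0; inr p1] -> f (under w) = f p0.
  by move=> /T-> /T->.
by rewrite !inE -!orbA => /or4P[]/eqP->.
Qed.

Definition transposition (i : index_s n) : 'S_n :=
  tperm (point_i i) (point_iS i).

Lemma compatible_s i f g :
  compatible (s_bar i) f g <-> forall x, f x = g (transposition i x).
Proof.
rewrite /transposition; split=> [fg x | fg A u v].
  case: tpermP => [->|->|/eqP xp /eqP xq].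
  - apply: (fg [set inl (point_i i); inr (point_iS i)] (inl _) (inr _));
      rewrite ?inE ?eqxx ?orbT //.
  - apply: (fg [set inl (point_iS i); inr (point_i i)] (inl _) (inr _));
      rewrite ?inE ?eqxx ?orbT //.
  - apply: (fg (through x) (inl x) (inr x)); rewrite ?in_through //.
    by rewrite !inE imset_f ?orbT // !inE (negPf xp) (negPf xq).
case/setU1P=> [->|/setU1P[->|/imsetP[x xpq ->]]].
- by move=> /set2P[]-> /set2P[]-> //=; rewrite fg tpermL.
- by move=> /set2P[]-> /set2P[]-> //=; rewrite fg tpermR.
rewrite !in_through; move: xpq; rewrite !inE negb_or => /andP[xp xq].
have fx : f x = g x by rewrite fg tpermD // eq_sym.
by case: u v => u [v|v] /= /eqP-> /eqP->.
Qed.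

(** The action of a permutation on colourings; the inverse makes it compatible
    with the left-to-right product of permutations, see [moveM]. *)
Definition move (s : 'S_n) f : {ffun 'I_n -> bool} :=
  [ffun x => f ((s^-1)%g x)].

Definition update x (c : bool) f : {ffun 'I_n -> bool} :=
  [ffun y => if y == x then c else f y].

(** A word read as a nondeterministic program that transforms the colouring of
    the upper row into that of the lower row: [s_i] permutes, [e] recolours
    point 1 arbitrarily, [t] proceeds only if points 1 and 2 agree. *)
Fixpoint run (w : seq (letter n)) f g : Prop :=
  match w with
  | [::] => f = g
  | Ls i :: w' => run w' (move (transposition i) f) g
  | Le :: w' => exists c, run w' (update p0 c f) g
  | Lt :: w' => f p0 = f p1 /\ run w' f g
  end.

Lemma move1 f : move 1 f = f.
Proof. by apply/ffunP=> x; rewrite ffunE invg1 perm1. Qed.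

Lemma moveM s1 s2 f : move s2 (move s1 f) = move (s1 * s2)%g f.
Proof. by apply/ffunP=> x; rewrite !ffunE invMg permM. Qed.

Lemma move_update s x c f : move s (update x c f) = update (s x) c (move s f).
Proof. by apply/ffunP=> y; rewrite !ffunE -(inj_eq (@perm_inj _ s)) permKV. Qed.

Lemma update_update x c d f : update x d (update x c f) = update x d f.
Proof. by apply/ffunP=> y; rewrite !ffunE; case: eqP. Qed.

Lemma update_comm x y c d f : x != y ->
  update x c (update y d f) = update y d (update x c f).
Proof.
by move=> xy; apply/ffunP=> z; rewrite !ffunE; case: (z =P x) => // ->;
  rewrite (negPf xy).
Qed.

Lemma update_id x f : update x (f x) f = f.
Proof. by apply/ffunP=> y; rewrite !ffunE; case: eqP => // ->. Qed.

Lemma run_compatible (w : seq (letter n)) f g : run w f g <->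
  compatible (Phi hn w) f g.
Proof.
rewrite /Phi; elim: w f => [|x w IHw] f.
  by rewrite free_hom_nil /=; symmetry; exact: compatible1.
rewrite -cat1s free_hom_cat free_hom_letter.
have -> : (compatible (gen_bar hn x * free_hom (gen_bar hn) w)%g f g <->
   exists2 h, compatible (gen_bar hn x) f h & run w h g).
  by rewrite compatibleM; split=> -[h fh hg]; exists h => //; apply/IHw.
case: x => [i||] /=.
- split=> [fg | [h /compatible_s fh]];
  first exists (move (transposition i) f) => //.
    by apply/compatible_s=> x; rewrite ffunE permK.
  by congr run; apply/ffunP=> x; rewrite ffunE fh permKV.
- split=> [[c fg] | [h /compatible_e fh hg]];
  first exists (update p0 c f) => //.
    by apply/compatible_e=> x; rewrite ffunE => /negPf->.
  exists (h p0); congr run: hg; apply/ffunP=> x; rewrite ffunE.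
  by case: eqP => [->|/eqP/fh].
- split=> [[f01 fg] | [h /compatible_t[f01 <-]]] //.
  by exists f => //; apply/compatible_t.
Qed.

Lemma Phi_eq u v : (forall f g, run u f g <-> run v f g) <->
  Phi hn u = Phi hn v.
Proof.
split=> [uv | uv f g]; last by rewrite !run_compatible uv.
by apply: compatible_inj => f g; rewrite -!run_compatible.
Qed.

(** * Soundness of the relations *)

Lemma transposition_fix i x : x.+1 < val i -> transposition i x = x.
Proof. by case: i => i /= lt_i xi; rewrite tpermD // -val_eqE /=; lia. Qed.

Lemma transposition1 s1 : val s1 = 1 -> transposition s1 = tperm p0 p1.
Proof. by move=> E; congr tperm; apply: val_inj; rewrite /= E. Qed.

Lemma transposition_comm i j : (val i).+1 < val j ->
  (transposition i * transposition j = transposition j * transposition i)%g.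
Proof.
move=> ij; apply: (mulgI (transposition j)^-1%g); rewrite mulKg mulgA.
have := tpermJ (point_i i) (point_iS i) (transposition j).
rewrite conjgE mulgA => ->; case: i ij => i /= lt_i ij.
by rewrite !transposition_fix //=; lia.
Qed.

Lemma transposition_braid i j : val j = (val i).+1 ->
  (transposition i * (transposition j * transposition i)
   = transposition j * (transposition i * transposition j))%g.
Proof.
move=> ij; rewrite /transposition (_ : point_i j = point_iS i); last first.
  by apply: val_inj; rewrite /= ij.
set p := point_i i; set q := point_iS i; set r := point_iS j.
have pq : p != q by rewrite -val_eqE /=; case: (i) => k /=; lia.
have pr : p != r by rewrite -val_eqE /= ij; case: (i) => k /=; lia.
have qr : q != r by rewrite -val_eqE /= ij; case: (i) => k /=; lia.
have H x y z : x != y -> x != z -> y != z ->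
    (tperm x y * (tperm y z * tperm x y) = tperm x z)%g.
  move=> xy xz yz; rewrite -{1}(tpermV x y) -conjgE tpermJ tpermR tpermD //
    eq_sym.
rewrite H // [tperm p q]tpermC [tperm q r]tpermC H // 1?eq_sym //.
exact: tpermC.
Qed.

Lemma sandwichK i j k :
  (transposition i * transposition k = transposition k * transposition i)%g ->
  let w := (transposition j * (transposition k
            * (transposition i * transposition j)))%g in
  (w * w = 1)%g.
Proof.
have tK l (s : 'S_n) : (transposition l * (transposition l * s) = s)%g.
  exact: tpermKg.
move=> ik w.
by rewrite /w -!mulgA tK (mulgA (transposition i)) ik -mulgA !tK tperm2.
Qed.

Lemma R_sound u v : R u v -> Phi hn u = Phi hn v.
Proof.
move=> uv; apply/Phi_eq => f g; case: uv => /=.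
- by move=> i; rewrite moveM tperm2 move1.
- move=> i j ij; rewrite !moveM.
  by case/orP: ij => /transposition_comm->.
- move=> i j ij; rewrite !moveM.
  by case/orP: ij => /eqP/transposition_braid->.
- split=> [[c [d]]|[c]]; rewrite ?update_update; first by exists d.
  by exists c, c; rewrite update_update.
- have p10 : (p1 == p0) = false by [].
  split=> [[c <-]|[c [_ [d]]]]; last first.
    by rewrite update_update; exists d.
  (* t requires at point 1 the colour of point 2 *)
  by exists (f p1); rewrite !ffunE eqxx p10; split => //; exists c;
    rewrite update_update.
- by split=> [[? []]|[? ?]].
- have p10 : (p1 == p0) = false by [].
  split=> [[f01 <-]|[f01 [c []]]]; last first.
    by rewrite !ffunE eqxx p10 => cf1; rewrite cf1 -f01 update_id.
  (* recolouring point 1 by its own colour changes nothing *)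
  by split=> //; exists (f p0); rewrite update_id.
- move=> s1 /transposition1->.
  have mf : f p0 = f p1 -> move (tperm p0 p1) f = f.
    by move=> f01; apply/ffunP=> x; rewrite ffunE tpermV; case: tpermP => // ->.
  split=> [[f01 [c []]]|[f01]]; rewrite mf //.
    by rewrite !ffunE eqxx /= => ->; rewrite -f01 update_id.
  by move=> fg; split=> //; exists (f p0); rewrite update_id.
- move=> s1 /transposition1->.
  rewrite !ffunE tpermV tpermL tpermR.
  by split=> -[].
- move=> i i2.
  by split=> -[c]; rewrite ?move_update ?transposition_fix // => fg; exists c;
    rewrite ?move_update ?transposition_fix.
- move=> i i3; rewrite !ffunE tpermV.
  have -> : tperm (point_i i) (point_iS i) p0 = p0 by apply: transposition_fix;
    apply: ltnW.
  by have -> : tperm (point_i i) (point_iS i) p1 =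
    p1 by apply: transposition_fix.
- move=> s1 /transposition1->.
  set m := move (tperm p0 p1).
  have E c d : m (update p0 c (m (update p0 d f)))
               = update p1 c (update p0 d f).
    by rewrite /m !move_update tpermL tpermR moveM tperm2 move1.
  have E' c d : update p0 c (m (update p0 d (m f)))
                = update p0 c (update p1 d f).
    by rewrite /m move_update tpermL moveM tperm2 move1.
  have C c d h : update p0 c (update p1 d h) = update p1 d (update p0 c h).
    by apply: update_comm.
  split=> -[c [d]]; rewrite ?E' ?E => fg; exists d, c; rewrite ?E ?E'.
    by rewrite -C.
  by rewrite C.
- move=> s1 /transposition1->.
  set m := move (tperm p0 p1).
  have E c d : m (update p0 c (m (update p0 d f)))
               = update p1 c (update p0 d f).
    by rewrite /m !move_update tpermL tpermR moveM tperm2 move1.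
  (* outside the recoloured points 1 and 2 the transposition does nothing *)
  have E' c d : update p0 c (m (update p0 d f)) = update p1 d (update p0 c f).
    rewrite /m !move_update tpermL update_comm //.
    apply/ffunP=> x; rewrite !ffunE tpermV.
    by case: eqP => // /eqP x1; case: eqP => // /eqP x0;
      rewrite tpermD // eq_sym.
  by split=> -[c [d]]; rewrite ?E ?E' => fg; exists d, c; rewrite ?E ?E'.
- move=> s2 _; rewrite !moveM tperm2 move1.
  by split=> -[? [? ?]].
- move=> s1 s2 s3 E1 E2 E3; rewrite !moveM.
  set w := (transposition s2 * _)%g.
  have ww : (w * w = 1)%g.
    by apply: sandwichK; apply: transposition_comm;
      rewrite [val s1]E1 [val s3]E3.
  by rewrite ww move1; split=> -[? [? ?]].
- move=> s1 s2 /transposition1 E1 E2; rewrite !moveM.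
  have s2p0 : transposition s2 p0 = p0 by apply: transposition_fix;
    rewrite [val s2]E2.
  have s2p1 : p1 = point_i s2 by apply: val_inj; rewrite /= E2.
  (* conjugating e by s_2 s_1 recolours point 3 *)
  have U c : move (transposition s1 * transposition s2)
     (update p0 c (move (transposition s2 * transposition s1) f))
     = update (point_iS s2) c f.
    rewrite move_update permM E1 tpermL s2p1 tpermL moveM mulgA.
    by rewrite -(mulgA (transposition s2)) tperm2 mulg1 tperm2 move1.
  have D c : (update (point_iS s2) c f p0 = f p0) *
    (update (point_iS s2) c f p1 = f p1).
    have v2 : point_iS s2 = 2 :> nat by exact: E2.
    have ne (x : 'I_n) : x < 2 -> (x == point_iS s2) = false.
      by move=> x2; apply/eqP=> E; rewrite E v2 in x2.
    by rewrite !ffunE !ne.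
  split=> [[f01 [c]]|[c]]; rewrite !moveM U.
    by exists c; rewrite !moveM U !D.
  by rewrite !D => -[f01 fg]; split=> //; exists c; rewrite !moveM U.
Qed.

Lemma cong_sound (u v : seq (letter n)) : u ≈ v -> Phi hn u = Phi hn v.
Proof.
elim=> [{}u {}v /R_sound||{}u {}v _ ->|{}u {}v w _ -> _ ->|
        {}u u' {}v v' _ uu' _ vv'] //.
by rewrite /Phi !free_hom_cat -!/(Phi hn _) uu' vv'.
Qed.

End Colourings.

(** * The Coxeter presentation of the symmetric group *)

Section Coxeter.
Variable n : nat.
Implicit Types (i j m : nat) (u v : seq nat).

(** Indexing the generators by all natural numbers, with trivial values out of
    range, frees the first two Coxeter relations from range conditions. *)
Definition adjacent_word i : seq (letter n) :=
  if insub i is Some k then [:: Ls (k : index_s n)] else [::].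

Definition adjacent_perm i : 'S_n :=
  if insub i is Some k then transposition (k : index_s n) else 1%g.

Definition adjacent_words u : seq (letter n) := flatten (map adjacent_word u).
Definition adjacent_perms u : 'S_n := (\prod_(i <- u) adjacent_perm i)%g.

Local Notation s := adjacent_word.

Lemma adjacent_words_cat u v :
  adjacent_words (u ++ v) = adjacent_words u ++ adjacent_words v.
Proof. by rewrite /adjacent_words map_cat flatten_cat. Qed.

Lemma adjacent_words1 i : adjacent_words [:: i] = s i.
Proof. exact: cats0. Qed.

Lemma adjacent_perms_cat u v :
  adjacent_perms (u ++ v) = (adjacent_perms u * adjacent_perms v)%g.
Proof. exact: big_cat. Qed.

Lemma adjacent_perms1 i : adjacent_perms [:: i] = adjacent_perm i.
Proof. exact: big_seq1. Qed.

Lemma adjacent_wordE i (lt_i : 0 < i < n) :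
  s i = [:: Ls (Sub i lt_i : index_s n)].
Proof. by rewrite /s insubT. Qed.

Lemma adjacent_wordK i : s i ++ s i ≈ [::].
Proof.
by rewrite /s; case: insubP => [k _ _|_] //=; apply: cong_rel; apply: R11.
Qed.

Lemma adjacent_word_comm i j :
  (i.+1 < j) || (j.+1 < i) -> s i ++ s j ≈ s j ++ s i.
Proof.
rewrite /s => ij; case: insubP => [k _ ki|_] /=; last by rewrite cats0.
case: insubP => [l _ lj|_] //=.
by apply: cong_rel; apply: R12; rewrite ki lj.
Qed.

Lemma adjacent_word_braid i : 0 < i -> i.+1 < n ->
  s i ++ s i.+1 ++ s i ≈ s i.+1 ++ s i ++ s i.+1.
Proof.
move=> i0 iSn; have lt_i : 0 < i < n by rewrite i0 ltnW.
rewrite (adjacent_wordE lt_i) (adjacent_wordE (i := i.+1) iSn).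
by apply/cong_rel/R13; rewrite eqxx.
Qed.

(** The indices [m], [m-1], ..., [m-j+1]: the corresponding product moves the
    point of value [m] to [m-j], so these products, for [j <= m], represent the
    cosets of the subgroup generated by [s_1], ..., [s_(m-1)]. *)
Definition descent m j : seq nat := [seq m - k | k <- iota 0 j].

Lemma descentS m j : descent m j.+1 = descent m j ++ [:: m - j].
Proof. by rewrite /descent -addn1 iotaD map_cat. Qed.

Local Notation sdescent m j := (adjacent_words (descent m j)).

Lemma sdescentS m j : sdescent m j.+1 = sdescent m j ++ s (m - j).
Proof. by rewrite descentS adjacent_words_cat adjacent_words1. Qed.

Lemma sdescent_comm m j i : i < m - j -> sdescent m j ++ s i ≈
  s i ++ sdescent m j.
Proof.
elim: j => [|j IHj] ij; first by rewrite /= cats0.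
rewrite sdescentS -catA adjacent_word_comm; last by lia.
by rewrite catA IHj -?catA //; lia.
Qed.

(** A letter strictly inside the descent crosses it with its index lowered by
    one: it commutes up to the two letters of neighbouring index and is moved
    across them by the braid relation. *)
Lemma sdescent_shift m j i : m < n -> j <= m -> m - j < i.-1 -> i <= m ->
  sdescent m j ++ s i ≈ s i.-1 ++ sdescent m j.
Proof.
move=> mn; elim: j => [|j IHj] jm ij im; first by lia.
have [ijm|ijm] := leqP i (m - j).+1; last first.
  rewrite sdescentS -catA.
  by rewrite adjacent_word_comm ?catA ?IHj -?catA //; lia.
case: j => [|j] in IHj jm ij ijm *; first by lia.
have [k ik] : exists k, i = k.+1 by exists i.-1; lia.
have e1 : m - j = k.+1 by lia.
have e2 : m - j.+1 = k by lia.
have braid : s k.+1 ++ s k ++ s k.+1 ≈ s k ++ s k.+1 ++ s k.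
  by symmetry; apply: adjacent_word_braid; lia.
rewrite ik !sdescentS e1 e2 -!catA braid /=.
have comm : sdescent m j ++ s k ≈ s k ++ sdescent m j by apply: sdescent_comm;
  lia.
by rewrite !catA comm.
Qed.

Lemma adjacent_permE i x :
  nat_of_ord (adjacent_perm i x) =
  if 0 < i < n then
    if x == i.-1 :> nat then i else if x == i :> nat then i.-1 else x
  else x.
Proof.
rewrite /adjacent_perm; case: insubP => [k /[dup] lt_i -> ki|/negPf->];
  last by rewrite perm1.
rewrite -ki /transposition; case: tpermP => [->|->|] /=.
- by rewrite eqxx.
- by rewrite eqxx; case: eqP; case: (k) => l /= *; lia.
- by move=> /eqP + /eqP; rewrite -!val_eqE /= => /negPf-> /negPf->.
Qed.

(** Multiplying the coset representative by [s_i] lengthens it, shortens it,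
    or lets a letter of index below [m] come out on its left, according to the
    position of [i] relative to the descent. *)
Lemma sdescent_coset m u : m < n -> all (fun i => 0 < i <= m) u ->
  exists u' j, [/\ all (fun i => 0 < i < m) u', j <= m &
    adjacent_words u ≈ adjacent_words u' ++ sdescent m j].
Proof.
move=> mn; elim/last_ind: u => [|u i IHu]; first by exists [::], 0.
rewrite all_rcons => /andP[/andP[i0 im] /IHu[u' [j [u'm jm uE]]]].
have {}uE : adjacent_words (rcons u i) ≈
  adjacent_words u' ++ sdescent m j ++ s i.
  by rewrite -cats1 adjacent_words_cat adjacent_words1 uE -catA.
have [ij|ij|ij] := ltngtP i (m - j).
- exists (rcons u' i), j; split=> //; first by rewrite all_rcons u'm; lia.
  by rewrite uE sdescent_comm // -cats1 adjacent_words_cat adjacent_words1 catA.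
- have [ij'|ij'] := eqVneq i (m - j).+1.
    have [k jk] : exists k, j = k.+1 by exists j.-1; lia.
    exists u', k; split=> //; first by lia.
    rewrite uE jk sdescentS -!catA (_ : m - k = i); last by lia.
    by rewrite adjacent_wordK cats0.
  exists (rcons u' i.-1), j; split=> //; first by rewrite all_rcons u'm; lia.
  rewrite uE sdescent_shift //; try by lia.
  by rewrite -cats1 adjacent_words_cat adjacent_words1 catA.
- exists u', j.+1; split=> //; first by lia.
  by rewrite uE sdescentS ij.
Qed.

Variable hn : 1 < n.

Lemma run_adjacent_words u f g :
  run hn (adjacent_words u) f g <-> move (adjacent_perms u) f = g.
Proof.
rewrite /adjacent_perms /adjacent_words.
elim: u f => [|i u IHu] f /=; first by rewrite big_nil move1.
rewrite big_cons -moveM /adjacent_word /adjacent_perm.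
by case: insubP => [k _ _|_]; rewrite /= ?move1 IHu.
Qed.

(** The permutation of a word is read off from its action on colourings. *)
Lemma adjacent_perms_cong u v : adjacent_words u ≈ adjacent_words v ->
  adjacent_perms u = adjacent_perms v.
Proof.
move/cong_sound/(Phi_eq hn) => uv.
apply/permP=> x.
pose f := [ffun y => y == x].
have /run_adjacent_words/ffunP/(_ (adjacent_perms u x)) :
  run hn (adjacent_words v) f (move (adjacent_perms u) f).
  by apply/uv/run_adjacent_words.
by rewrite !ffunE permK eqxx => /eqP E; rewrite -{2}E permKV.
Qed.

Lemma adjacent_perms_bounded m u (x : 'I_n) :
  all (fun i => 0 < i < m) u -> m <= x -> adjacent_perms u x = x.
Proof.
move=> + mx; elim: u x mx => [|i u IHu] x mx /=.
  by rewrite /adjacent_perms big_nil perm1.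
rewrite /adjacent_perms big_cons permM => /andP[im um].
have -> : adjacent_perm i x = x.
  by apply: val_inj; rewrite /= adjacent_permE; case: ifP => // _;
    rewrite !ifN_eq //=; lia.
exact: IHu.
Qed.

Lemma descent_top m j (x : 'I_n) : val x = m -> j <= m ->
  adjacent_perms (descent m j) x = m - j :> nat.
Proof.
move=> xm; elim: j => [|j IHj] jm.
  by rewrite /adjacent_perms big_nil perm1 subn0.
rewrite descentS adjacent_perms_cat permM adjacent_perms1.
rewrite adjacent_permE IHj; last by lia.
have := ltn_ord x; rewrite [nat_of_ord x]xm.
by case: ifP => [_|]; [rewrite ifN_eq ?eqxx|]; lia.
Qed.

(** The image of the point [m+1] identifies the coset representative, and
    cancelling it leaves words in fewer letters. *)
Lemma coxeter_bounded m u v : m < n ->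
  all (fun i => 0 < i <= m) u -> all (fun i => 0 < i <= m) v ->
  adjacent_perms u = adjacent_perms v -> adjacent_words u ≈ adjacent_words v.
Proof.
elim: m u v => [|m IHm] u v mn um vm uv.
  by case: u v um vm {uv} => [|[|i] u] [|[|j] v].
have [u' [j [u'm jm uE]]] := sdescent_coset mn um.
have [v' [k [v'm km vE]]] := sdescent_coset mn vm.
move: uv.
rewrite -adjacent_words_cat in uE; rewrite -adjacent_words_cat in vE.
rewrite (adjacent_perms_cong uE) (adjacent_perms_cong vE) !adjacent_perms_cat =>
  uv.
have jk : j = k.
  have := congr1 (fun s : 'S_n => nat_of_ord (s (Ordinal mn))) uv.
  rewrite !permM (adjacent_perms_bounded u'm) //
    (adjacent_perms_bounded v'm) //.
  by rewrite !(@descent_top m.+1) //; lia.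
rewrite uE vE jk !adjacent_words_cat (IHm u' v') //; first exact: ltnW.
by move: uv; rewrite jk => /mulIg.
Qed.

Lemma coxeter u v :
  adjacent_perms u = adjacent_perms v -> adjacent_words u ≈ adjacent_words v.
Proof.
have fw w : adjacent_words w = adjacent_words [seq i <- w | 0 < i < n].
  elim: w => //= i w IHw; case: ifP => i_n;
    rewrite /adjacent_words /= -!/(adjacent_words _) IHw //.
  by rewrite /adjacent_word insubF.
have fp w : adjacent_perms w = adjacent_perms [seq i <- w | 0 < i < n].
  elim: w => //= i w IHw; case: ifP => i_n;
    rewrite /adjacent_perms !big_cons -!/(adjacent_perms _) IHw //.
  by rewrite /adjacent_perm insubF // mul1g.
have fa w : all (fun i => 0 < i <= n.-1) [seq i <- w | 0 < i < n].
  by rewrite all_filter; apply/allP=> i _ /=; lia.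
rewrite fw (fw v) fp (fp v) => uv.
by apply: (@coxeter_bounded n.-1) => //; lia.
Qed.
End Coxeter.

(** * Permutations of a finite type *)

(** Composing [s] with the transposition of [x] and [s x] makes [s x] a fixed
    point, without creating any moved point. *)
Lemma perm_on_ind (T : finType) (A : pred T) (Q : {perm T} -> Prop) :
  Q 1%g ->
  (forall x y (s : {perm T}), A x -> A y -> x != y -> Q s ->
    Q (tperm x y * s)%g) ->
  forall s : {perm T}, (forall x, ~~ A x -> s x = x) -> Q s.
Proof.
move=> Q1 QM s; have [k] := ubnP #|[set x | s x != x]|.
elim: k s => // k IHk s sk sA.
have [/existsP[x sx]|/existsPn fix_s] := boolP [exists x, s x != x]; last first.
  suff -> : s = 1%g by [].
  by apply/permP=> x; rewrite perm1; apply/eqP; rewrite -[_ == _]negbK fix_s.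
have AE y : s y != y -> A y by apply: contraR => /sA->.
have ssx : s (s x) != s x by rewrite (inj_eq (@perm_inj _ s)).
rewrite -(tpermKg x (s x) s); apply: QM; rewrite ?AE // 1?eq_sym //.
have sub y : (tperm x (s x) * s)%g y != y -> (s y != y) && (y != s x).
  rewrite permM; case: tpermP => [->|->|_ /eqP ysx]; rewrite ?eqxx //.
    by rewrite (eq_sym x) sx.
  by rewrite ysx andbT.
apply: IHk => [|y Ay]; last first.
  by apply/eqP; apply: contraR Ay => /sub/andP[/AE].
apply: leq_trans (_ : #|[set y | s y != y] :\ s x| < k).
  by rewrite ltnS; apply/subset_leq_card/subsetP=> y;
    rewrite !inE => /sub/andP[-> ->].
by move: sk; rewrite (cardsD1 (s x)) inE ssx.
Qed.

(** Complete both sequences to enumerations of the type, and match positions. *)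
Lemma perm_extend (T : finType) (s s' : seq T) :
  uniq s -> uniq s' -> size s = size s' -> exists p : {perm T}, map p s = s'.
Proof.
case: s' => [|x0 s'].
  by move=> _ _ /size0nil->; exists 1%g.
move: (x0 :: s') => {}s' us us' ss'.
pose full r := r ++ [seq x <- enum T | x \notin r].
have ufull r : uniq r -> uniq (full r).
  move=> ur; rewrite cat_uniq ur filter_uniq ?enum_uniq // andbT.
  by apply/hasPn=> x; rewrite mem_filter => /andP[].
have mfull r x : x \in full r.
  by rewrite mem_cat mem_filter mem_enum andbT orbN.
have sfull r : uniq r -> size (full r) = #|T|.
  move=> /ufull/card_uniqP <-; apply: eq_card => x; exact: mfull.
pose f x := nth x (full s') (index x (full s)).
have lt_s x : index x (full s) < size (full s').
  by rewrite sfull // -(sfull s) // index_mem.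
have f_inj : injective f.
  move=> x y; rewrite /f (set_nth_default y) // => /eqP.
  rewrite nth_uniq ?ufull // => /eqP; exact: index_inj.
exists (perm f_inj).
apply: (@eq_from_nth _ x0); rewrite ?size_map // => i lt_i.
rewrite (nth_map x0) // permE /f /full.
rewrite index_cat mem_nth // index_uniq // (set_nth_default x0).
  by rewrite nth_cat -ss' lt_i.
by rewrite size_cat -ss' ltn_addr.
Qed.

(** * Equivalences generated by lists of pairs *)

Section Linked.
Variable T : finType.
Implicit Types (x y : T) (L : seq (T * T)).

Definition edge L : rel T :=
  fun x y => ((x, y) \in L) || ((y, x) \in L).
Definition linked L := connect (edge L).

Lemma edge_sym L : symmetric (edge L).
Proof. by move=> x y; rewrite /edge orbC. Qed.

Lemma linked_sym L : symmetric (linked L).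
Proof. exact: sym_connect_sym (edge_sym L). Qed.

Lemma linked_mem L x y : (x, y) \in L -> linked L x y.
Proof. by move=> xy; apply: connect1; rewrite /edge xy. Qed.

(** A chosen element of the class of [x], the same for the whole class. *)
Definition rep L x := odflt x [pick y | linked L x y].

Lemma rep_linked L x : linked L x (rep L x).
Proof.
by rewrite /rep; case: pickP => [y //|/(_ x)]; rewrite /linked connect0.
Qed.

Lemma linked_rep L x y : linked L x y -> rep L x = rep L y.
Proof.
move=> xy; have E : linked L x =1 linked L y :=
  same_connect (sym_connect_sym (edge_sym L)) xy.
rewrite /rep (eq_pick E); case: pickP => // /(_ y); by rewrite /linked connect0.
Qed.

Lemma rep_idem L x : rep L (rep L x) = rep L x.
Proof. by rewrite -(linked_rep (rep_linked L x)). Qed.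

Lemma eq_rep L L' : linked L =2 linked L' -> rep L =1 rep L'.
Proof. by move=> LL' x; rewrite /rep (eq_pick (LL' x)). Qed.

Lemma linked_eq L (f : T -> bool) : (forall p, p \in L -> f p.1 = f p.2) ->
  forall x y, linked L x y -> f x = f y.
Proof.
move=> fL x y /connectP[p + ->]; elim: p x => //= z p IHp x /andP[xz /IHp <-].
by case/orP: xz => /fL /= ->.
Qed.

Lemma card_notin_cons x (A : seq T) : x \notin A ->
  #|[pred z | z \notin x :: A]| < #|[pred z | z \notin A]|.
Proof.
move=> xA; apply: proper_card; apply/properP; split.
  by apply/subsetP=> z; rewrite !inE negb_or => /andP[].
by exists x; rewrite !inE ?eqxx.
Qed.

End Linked.

(** * Words for permutations *)

Section PermutationWords.
Variable n : nat.

(** Permutations fixing the points below [k] are products of the [s_i] with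
    [i > k]; every other transposition of such points is a conjugate of one of
    smaller span. *)
Lemma transposition_ind (k : nat) (Q : 'S_n -> Prop) :
  Q 1%g -> (forall s s', Q s -> Q s' -> Q (s * s')%g) ->
  (forall i : index_s n, k < val i -> Q (transposition i)) ->
  forall s : 'S_n, (forall x : 'I_n, x < k -> s x = x) -> Q s.
Proof.
move=> Q1 QM Qt s fix_s.
have lt_tperm (d : nat) (x y : 'I_n) : k <= x -> y = x + d.+1 :> nat ->
  Q (tperm x y).
  elim: d y => [|d IHd] y kx yE.
    have y_n : 0 < y < n by have := ltn_ord y; lia.
    have -> : tperm x y = transposition (Sub (val y) y_n : index_s n).
      by congr tperm; apply: val_inj => /=; lia.
    by apply: Qt => /=; lia.
  have y'_n : y.-1 < n by have := ltn_ord y; lia.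
  pose y' := Ordinal y'_n.
  have Qxy' : Q (tperm x y') by apply: IHd => //=; lia.
  have y_n : 0 < y < n by have := ltn_ord y; lia.
  have Qy'y : Q (tperm y' y).
    have -> : tperm y' y = transposition (Sub (val y) y_n : index_s n).
      by congr tperm; apply: val_inj.
    by apply: Qt => /=; lia.
  have := tpermJ x y' (tperm y' y); rewrite tpermL tpermD; last 2 first.
  - by rewrite -val_eqE /=; lia.
  - by rewrite -val_eqE /=; lia.
  move=> <-; rewrite conjgE tpermV; exact: (QM _ _ Qy'y (QM _ _ Qxy' Qy'y)).
apply: (perm_on_ind (A := fun x : 'I_n => k <= x)) => //
  [x y s' kx ky xy Qs'|x].
  apply: QM => //; have [lt_xy|lt_yx|xy'] := ltngtP x y.
  - by apply: (lt_tperm (y - x).-1) => //; lia.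
  - by rewrite tpermC; apply: (lt_tperm (x - y).-1) => //; lia.
  - by rewrite -val_eqE /= xy' eqxx in xy.
by rewrite -ltnNge => /fix_s.
Qed.

Lemma adjacent_perm_transposition (i : index_s n) :
  adjacent_perm n (val i) = transposition i.
Proof. by rewrite /adjacent_perm valK. Qed.

Lemma adjacent_perms_surj (s : 'S_n) : exists u, adjacent_perms n u == s.
Proof.
apply: (@transposition_ind 0 (fun s => exists u,
  adjacent_perms n u == s)) => //.
- by exists [::]; rewrite /adjacent_perms big_nil.
- move=> _ _ [u /eqP <-] [v /eqP <-]; exists (u ++ v).
  by rewrite adjacent_perms_cat.
by move=> i _; exists [:: val i];
  rewrite adjacent_perms1 adjacent_perm_transposition.
Qed.

Definition perm_word (s : 'S_n) : seq (letter n) :=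
  adjacent_words n (xchoose (adjacent_perms_surj s)).

Hypothesis hn : 1 < n.

Lemma perm_word_adjacent u : perm_word (adjacent_perms n u) ≈
  adjacent_words n u.
Proof.
by apply: (coxeter hn); apply/eqP/(xchooseP (adjacent_perms_surj _)).
Qed.

Lemma perm_word1 : perm_word 1 ≈ [::].
Proof.
by rewrite -(_ : adjacent_perms n [::] = 1%g) ?perm_word_adjacent //
  /adjacent_perms big_nil.
Qed.

Lemma perm_wordM s s' : perm_word (s * s') ≈ perm_word s ++ perm_word s'.
Proof.
have /eqP {1}<- := xchooseP (adjacent_perms_surj s).
have /eqP {1}<- := xchooseP (adjacent_perms_surj s').
by rewrite -adjacent_perms_cat perm_word_adjacent adjacent_words_cat.
Qed.

Lemma perm_word_letter i : perm_word (transposition i) ≈ [:: Ls i].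
Proof.
rewrite -adjacent_perm_transposition -adjacent_perms1 perm_word_adjacent.
by rewrite adjacent_words1 /adjacent_word valK.
Qed.

Lemma perm_wordV s : perm_word s^-1 ++ perm_word s ≈ [::].
Proof. by rewrite -perm_wordM mulVg perm_word1. Qed.

Lemma perm_wordVr s : perm_word s ++ perm_word s^-1 ≈ [::].
Proof. by rewrite -perm_wordM mulgV perm_word1. Qed.

Definition comm (u v : seq (letter n)) := u ++ v ≈ v ++ u.

Lemma comm_perm_word (k : nat) u (s : 'S_n) :
  (forall i : index_s n, k < val i -> comm u [:: Ls i]) ->
  (forall x : 'I_n, x < k -> s x = x) -> comm u (perm_word s).
Proof.
move=> comm_u fix_s; apply:
  (@transposition_ind k (fun s => comm u (perm_word s))) => //.
- by rewrite /comm perm_word1 cats0.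
- move=> s1 s2 c1 c2; rewrite /comm perm_wordM catA c1 -catA c2 catA //.
- by move=> i /comm_u; rewrite /comm perm_word_letter.
Qed.

Definition conj (s : 'S_n) u := perm_word s^-1 ++ u ++ perm_word s.

#[global] Instance conj_cong : Proper (eq ==> @cong n ==> @cong n) conj.
Proof. by move=> s _ <- u v uv; rewrite /conj uv. Qed.

Lemma conj1 u : conj 1 u ≈ u.
Proof. by rewrite /conj invg1 perm_word1 cats0. Qed.

Lemma conjM s s' u : conj s' (conj s u) ≈ conj (s * s') u.
Proof. by rewrite /conj invMg !perm_wordM -!catA. Qed.

Lemma conj_cat s u v : conj s (u ++ v) ≈ conj s u ++ conj s v.
Proof.
rewrite /conj -!catA (catA (perm_word s) (perm_word _)) perm_wordVr //.
Qed.

Lemma conj_perm_word s s' : conj s (perm_word s') ≈ perm_word (s' ^ s).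
Proof. by rewrite /conj conjgE !perm_wordM. Qed.

Lemma conjE s u : u ++ perm_word s ≈ perm_word s ++ conj s u.
Proof. by rewrite /conj catA perm_wordVr. Qed.

Lemma conj_fix s u : comm u (perm_word s) -> conj s u ≈ u.
Proof. by move=> us; rewrite /conj us catA perm_wordV. Qed.

(** * Cuts and merges *)

Local Notation W := perm_word.
Local Notation p0 := (point1 hn).
Local Notation p1 := (point2 hn).
Implicit Types (x y z : 'I_n) (s : 'S_n) (u v w : seq (letter n)).

Definition cut x : seq (letter n) :=
  if [pick s : 'S_n | s p0 == x] is Some s then conj s [:: Le] else [::].

(** When [x = y] there is no such permutation and the value is the empty word,
    as befits merging a line with itself; see [mergexx]. *)
Definition merge x y : seq (letter n) :=
  if [pick s : 'S_n | (s p0 == x) && (s p1 == y)] is Some s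
  then conj s [:: Lt] else [::].

Let first_transposition_lt : 0 < 1 < n. Proof. exact: hn. Qed.

Definition s1 : index_s n := Sub 1 first_transposition_lt.

Lemma transposition_s1 : transposition s1 = tperm p0 p1.
Proof. exact: transposition1. Qed.

Lemma W_s1 : W (tperm p0 p1) ≈ [:: Ls s1].
Proof. by rewrite -transposition_s1 perm_word_letter. Qed.

Lemma comm_e s : s p0 = p0 -> comm [:: Le] (W s).
Proof.
move=> sp0; apply: (@comm_perm_word 1) => [i i1|x x0].
  by apply/cong_rel/R16.
by rewrite (_ : x = p0) //; apply: val_inj => /=; lia.
Qed.

Lemma comm_t s : s p0 = p0 -> s p1 = p1 -> comm [:: Lt] (W s).
Proof.
move=> sp0 sp1; apply: (@comm_perm_word 2) => [i i1|x x1].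
  by apply/cong_rel/R17.
case: x x1 => -[|[|k]] // lt_k _.
  by rewrite (_ : Ordinal _ = p0) //; apply: val_inj.
by rewrite (_ : Ordinal _ = p1) //; apply: val_inj.
Qed.

(** Two permutations sending point 1 to the same point differ by one that
    fixes it, which commutes with [e]. *)
Lemma cut_conj s : cut (s p0) ≈ conj s [:: Le].
Proof.
rewrite /cut; case: pickP => [s' /eqP s's|/(_ s)]; last by rewrite eqxx.
rewrite -(mulgKV s' s) -conjM (conj_fix (s := _ * _)) //.
by apply: comm_e; rewrite permM -s's permK.
Qed.

Lemma merge_conj s : merge (s p0) (s p1) ≈ conj s [:: Lt].
Proof.
rewrite /merge; case: pickP => [s' /andP[/eqP s's /eqP s's1]|/(_ s)];
  last by rewrite !eqxx.
rewrite -(mulgKV s' s) -conjM (conj_fix (s := _ * _)) //.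
by apply: comm_t; rewrite permM -?s's -?s's1 permK.
Qed.

Lemma cut_e : cut p0 ≈ [:: Le].
Proof. by rewrite -{1}(perm1 p0) cut_conj conj1. Qed.

Lemma merge_t : merge p0 p1 ≈ [:: Lt].
Proof. by rewrite -{1}(perm1 p0) -{1}(perm1 p1) merge_conj conj1. Qed.

Lemma mergexx x : merge x x = [::].
Proof.
rewrite /merge; case: pickP => // s /andP[/eqP <-].
by rewrite (inj_eq (@perm_inj _ s)).
Qed.

(* An identity between cuts and merges at given points follows from the one at
   the first points by conjugation, because permutations are transitive on
   tuples of distinct points. *)

Lemma perm_map1 x : exists s, s p0 = x.
Proof.
by have [//|//|//|s [<-]] := @perm_extend _ [:: p0] [:: x]; exists s.
Qed.

Lemma perm_map2 x y : x != y -> exists s, s p0 = x /\ s p1 = y.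
Proof.
move=> xy; have [//||//|s [<- <-]] := @perm_extend _ [:: p0; p1] [:: x; y].
  by rewrite /= inE xy.
by exists s.
Qed.

Lemma conj_cut s x : conj s (cut x) ≈ cut (s x).
Proof.
by have [s' <-] := perm_map1 x; rewrite cut_conj conjM -permM cut_conj.
Qed.

Lemma conj_merge s x y : conj s (merge x y) ≈ merge (s x) (s y).
Proof.
have [<-|/perm_map2[s' [<- <-]]] := eqVneq x y.
  by rewrite !mergexx /conj /= perm_wordV.
by rewrite merge_conj conjM -!permM merge_conj.
Qed.

Lemma cut_perm s x : cut x ++ W s ≈ W s ++ cut (s x).
Proof. by rewrite conjE conj_cut. Qed.

Lemma merge_perm s x y : merge x y ++ W s ≈ W s ++ merge (s x) (s y).
Proof. by rewrite conjE conj_merge. Qed.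

Lemma cutK x : cut x ++ cut x ≈ cut x.
Proof.
have [s <-] := perm_map1 x; rewrite !cut_conj -conj_cat.
by rewrite (_ : _ ++ _ ≈ [:: Le]) //; apply/cong_rel/R14a.
Qed.

Lemma cut_p1 : cut p1 ≈ [:: Ls s1; Le; Ls s1].
Proof. by rewrite -{1}(tpermL p0 p1) cut_conj /conj tpermV W_s1. Qed.

Lemma cut_comm x y : comm (cut x) (cut y).
Proof.
have [<-|/perm_map2[s [<- <-]]] := eqVneq x y; first exact: congxx.
rewrite /comm -!conj_cut -!conj_cat; apply: conj_cong => //.
rewrite cut_e cut_p1 /=; symmetry.
by apply: cong_rel; apply: R18a.
Qed.

Lemma cut_tperm x y : x != y -> cut x ++ cut y ++ W (tperm x y) ≈
  cut x ++ cut y.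
Proof.
move=> /perm_map2[s [<- <-]].
rewrite -tpermJ -conj_perm_word -!conj_cut -!conj_cat; apply: conj_cong => //.
rewrite cut_e cut_p1 W_s1 /=.
transitivity ([:: Le; Ls s1; Le]).
  rewrite -(cats0 [:: Le; Ls s1; Le]) -[X in X ≈
    _]/([:: Le; Ls s1; Le] ++ [:: Ls s1; Ls s1]).
  by apply: cat_cong => //; apply/cong_rel/R11.
by symmetry; apply/cong_rel/R18b.
Qed.

Lemma merge_sym x y : merge x y ≈ merge y x.
Proof.
have [<-|/perm_map2[s [<- <-]]] := eqVneq x y; first exact: congxx.
rewrite -!conj_merge; apply: conj_cong => //.
rewrite merge_t -{1}(tpermL p0 p1) -{3}(tpermR p0 p1) merge_conj /conj tpermV
  W_s1.
symmetry.
rewrite (_ : [:: Lt] ++ [:: Ls s1] ≈ [:: Ls s1] ++ [:: Lt]);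
  last by apply/cong_rel/R15d.
by rewrite catA (_ : [:: Ls s1] ++ [:: Ls s1] ≈ [::]) //; apply/cong_rel/R11.
Qed.

Lemma mergeK x y : merge x y ++ merge x y ≈ merge x y.
Proof.
have [<-|/perm_map2[s [<- <-]]] := eqVneq x y; first by rewrite mergexx.
rewrite !merge_conj -conj_cat; apply: conj_cong => //.
exact/cong_rel/R15a.
Qed.

Lemma merge_tperm x y : merge x y ++ W (tperm x y) ≈ merge x y.
Proof.
have [<-|/perm_map2[s [<- <-]]] := eqVneq x y;
  first by rewrite tperm1 perm_word1 cats0.
rewrite -tpermJ -conj_perm_word !merge_conj -!conj_cat; apply: conj_cong => //.
rewrite W_s1; symmetry.
transitivity [:: @Lt n; Le; Lt]; first exact/cong_rel/R15b.
exact/cong_rel/R15c.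
Qed.

Lemma cut_merge_cut x y : x != y -> cut x ++ merge x y ++ cut x ≈ cut x.
Proof.
move=> /perm_map2[s [<- <-]].
rewrite !cut_conj merge_conj -!conj_cat; apply: conj_cong => //.
by symmetry; apply/cong_rel/R14b.
Qed.

Lemma merge_cut_merge x y : x != y -> merge x y ++ cut x ++ merge x y ≈
  merge x y.
Proof.
move=> /perm_map2[s [<- <-]].
rewrite !cut_conj merge_conj -!conj_cat; apply: conj_cong => //.
by symmetry; apply/cong_rel/R15b.
Qed.

Section Third.
Hypothesis n2 : 2 < n.
Definition p2 : 'I_n := Ordinal n2.
Definition s2 : index_s n := Sub 2 (n2 : 0 < 2 < n).

Lemma transposition_s2 : transposition s2 = tperm p1 p2.
Proof. by congr tperm; apply: val_inj. Qed.

Lemma W_s2 : W (tperm p1 p2) ≈ [:: Ls s2].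
Proof. by rewrite -transposition_s2 perm_word_letter. Qed.

Lemma merge_p0p2 : merge p0 p2 ≈ [:: Ls s2; Lt; Ls s2].
Proof.
rewrite -{1}(tpermL p1 p2) -(_ : tperm p1 p2 p0 = p0); last by rewrite tpermD.
by rewrite merge_conj /conj tpermV W_s2.
Qed.

Lemma cut_p2 : cut p2 ≈ [:: Ls s2; Ls s1; Le; Ls s1; Ls s2].
Proof.
have <- : (tperm p0 p1 * tperm p1 p2)%g p0 = p2 by rewrite permM !tpermL.
rewrite cut_conj /conj invMg !tpermV.
by rewrite !perm_wordM W_s1 W_s2.
Qed.

Lemma merge_comm_base : comm (merge p0 p1) (merge p0 p2).
Proof. rewrite /comm merge_t merge_p0p2; exact/cong_rel/R19. Qed.

Lemma merge_cut_base : comm (merge p0 p1) (cut p2).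
Proof. rewrite /comm merge_t cut_p2; exact/cong_rel/R21. Qed.

Lemma perm_map3 x y z : x != y -> x != z -> y != z ->
  exists s, [/\ s p0 = x, s p1 = y & s p2 = z].
Proof.
move=> xy xz yz; have [//||//|s [<- <- <-]] :=
  @perm_extend _ [:: p0; p1; p2] [:: x; y; z].
  by rewrite /= !inE negb_or xy xz yz.
by exists s.
Qed.
End Third.

Lemma lt_size_uniq (xs : seq 'I_n) k : uniq xs -> k < size xs -> k < n.
Proof.
by move/card_uniqP=> <- /leq_trans -> //;
  rewrite -[X in _ <= X]card_ord max_card.
Qed.

Lemma merge_cut_comm x y z : z != x -> z != y -> comm (merge x y) (cut z).
Proof.
move=> zx zy; have [<-|xy] := eqVneq x y; first by rewrite mergexx /comm cats0.
have n2 : 2 < n by apply: (@lt_size_uniq [:: x; y; z]);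
  rewrite //= !inE negb_or xy !(eq_sym _ z) zx zy.
have [||s [<- <- <-]] := perm_map3 n2 xy (z := z); rewrite 1?eq_sym //.
rewrite /comm -!conj_cut -!conj_merge -!conj_cat; apply: conj_cong => //.
exact: merge_cut_base.
Qed.

Lemma merge_comm_share x y z : comm (merge x y) (merge x z).
Proof.
have [<-|xy] := eqVneq x y; first by rewrite mergexx /comm cats0.
have [<-|xz] := eqVneq x z; first by rewrite mergexx /comm cats0.
have [<-|yz] := eqVneq y z; first exact: congxx.
have n2 : 2 < n by apply: (@lt_size_uniq [:: x; y; z]);
  rewrite //= !inE negb_or xy xz yz.
have [s [<- <- <-]] := perm_map3 n2 xy xz yz.
rewrite /comm -!conj_merge -!conj_cat; apply: conj_cong => //.
exact: merge_comm_base.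
Qed.

(** Insert the transposition of [x] and [y], which the merge absorbs, and
    let it turn [y] into [x]. *)
Lemma merge_trans x y z : merge x y ++ merge y z ≈ merge x y ++ merge x z.
Proof.
have [<-|zy] := eqVneq y z; first by rewrite mergexx cats0 mergeK.
have [<-|zx] := eqVneq x z; first by rewrite mergexx cats0 (merge_sym y) mergeK.
have xz_perm := merge_perm (tperm x y) x z.
rewrite tpermL tpermD // in xz_perm.
by rewrite -{1}merge_tperm -catA -xz_perm catA merge_comm_share -catA
  merge_tperm.
Qed.

(** The permutation [s_2 s_3 s_1 s_2] exchanges points 1, 2 with 3, 4, so that
    the conjugate of [t] by it is the merge of points 3 and 4. *)
Lemma merge_comm_disjoint x y z t : uniq [:: x; y; z; t] ->
  comm (merge x y) (merge z t).
Proof.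
move=> xyzt; have n3 : 3 < n by apply: (lt_size_uniq xyzt).
pose p3 : 'I_n := Ordinal n3.
pose s3 : index_s n := Sub 3 (n3 : 0 < 3 < n).
pose s2' : index_s n := s2 (ltnW n3).
pose p2' : 'I_n := p2 (ltnW n3).
have [//|//|//|s [<- <- <- <-]] := @perm_extend _ [:: p0; p1; p2'; p3] [:: x; y;
  z; t].
rewrite /comm -!conj_merge -!conj_cat; apply: conj_cong => //.
have M : merge p2' p3 ≈ [:: Ls s2'; Ls s3; Ls s1; Ls s2'; Lt; Ls s2'; Ls s3;
  Ls s1; Ls s2'].
  have s2_ : transposition s2' = tperm p1 p2' by apply: transposition_s2.
  have s3_ : transposition s3 = tperm p2' p3 by congr tperm; apply: val_inj.
  pose w := (transposition s2' *
    (transposition s3 * (transposition s1 * transposition s2')))%g.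
  have <- : w p0 = p2'.
    by rewrite !permM s2_ s3_ transposition_s1 (tpermD (z := p0)) //
      (tpermD (z := p0)) // !tpermL.
  have <- : w p1 = p3.
    by rewrite !permM s2_ s3_ transposition_s1 !tpermL tpermD // tpermD.
  rewrite merge_conj /conj; have -> : (w^-1 = w)%g.
    by apply/(mulgI w); rewrite mulgV sandwichK //; apply: transposition_comm.
  by rewrite /w !perm_wordM !perm_word_letter.
rewrite merge_t M.
have := @R20 n s1 s2' s3 erefl erefl erefl.
exact: cong_rel.
Qed.

Lemma comm_cat u v w : comm u v -> comm u w -> comm u (v ++ w).
Proof. by rewrite /comm => uv uw; rewrite catA uv -catA uw catA. Qed.

Lemma comm_sym u v : comm u v -> comm v u.
Proof. by rewrite /comm => ->. Qed.

Lemma merge_comm x y z t : comm (merge x y) (merge z t).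
Proof.
have share a b c : comm (merge a b) (merge c a).
  by rewrite /comm (merge_sym c) merge_comm_share.
have [<-|xz] := eqVneq x z; first exact: merge_comm_share.
have [<-|xt] := eqVneq x t; first exact: share.
have [<-|yz] := eqVneq y z;
  first by rewrite /comm (merge_sym x) merge_comm_share.
have [<-|yt] := eqVneq y t; first by rewrite /comm (merge_sym x) share.
have [<-|xy] := eqVneq x y; first by rewrite mergexx /comm cats0.
have [<-|zt] := eqVneq z t; first by rewrite mergexx /comm cats0.
by apply: merge_comm_disjoint; rewrite /= !inE !negb_or xy xz xt yz yt zt.
Qed.

(** * Products of cuts and of merges *)

Section CommutingIdempotents.
Variables (I : eqType) (F : I -> seq (letter n)).
Hypothesis F_idem : forall i, F i ++ F i ≈ F i.
Hypothesis F_comm : forall i j, comm (F i) (F j).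

Definition product (r : seq I) := flatten [seq F i | i <- r].

Lemma product_cat r r' : product (r ++ r') = product r ++ product r'.
Proof. by rewrite /product map_cat flatten_cat. Qed.

Lemma comm_product u r : (forall i, i \in r -> comm u (F i)) ->
  comm u (product r).
Proof.
elim: r => [|i r IHr] ur; first by rewrite /comm cats0.
apply: comm_cat; first by apply: ur; rewrite mem_head.
by apply: IHr => j jr; apply: ur; rewrite in_cons jr orbT.
Qed.

Lemma product_absorb i r : i \in r -> product r ++ F i ≈ product r.
Proof.
elim: r => // j r IHr; rewrite in_cons => /predU1P[->|/IHr ir].
  have c : comm (F j) (product r) by apply: comm_product.
  by rewrite -[product _]/(F j ++ product r) -catA -c catA F_idem.
by rewrite -[product _]/(F j ++ product r) -catA ir.
Qed.

Lemma product_sub r r' : {subset r' <= r} -> product r ++ product r' ≈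
  product r.
Proof.
elim: r' => [|i r' IHr'] sub; first by rewrite cats0.
rewrite -[product (i :: r')]/(F i ++ product r') catA product_absorb;
  last first.
  by apply: sub; rewrite mem_head.
by apply: IHr' => j jr; apply: sub; rewrite in_cons jr orbT.
Qed.

Lemma product_comm r r' : comm (product r) (product r').
Proof. by apply: comm_product => i _; apply/comm_sym/comm_product. Qed.

Lemma eq_product r r' : r =i r' -> product r ≈ product r'.
Proof.
move=> rr'; rewrite -(product_sub (r' := r')) => [|i]; last by rewrite rr'.
by rewrite product_comm product_sub // => i; rewrite rr'.
Qed.
End CommutingIdempotents.

Definition cuts (A : seq 'I_n) := product cut A.
Definition merges (L : seq ('I_n * 'I_n)) := product (fun p => merge p.1 p.2) L.

Lemma cuts_absorb x A : x \in A -> cuts A ++ cut x ≈ cuts A.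
Proof. exact: (product_absorb cutK cut_comm). Qed.

Lemma eq_cuts A A' : A =i A' -> cuts A ≈ cuts A'.
Proof. exact: (eq_product cutK cut_comm). Qed.

Lemma cuts_cons x A : cuts (x :: A) ≈ cuts A ++ cut x.
Proof. by apply: comm_product => y _; apply: cut_comm. Qed.

Lemma merges_cat L L' : merges (L ++ L') = merges L ++ merges L'.
Proof. exact: product_cat. Qed.

Lemma merges1 x y : merges [:: (x, y)] = merge x y.
Proof. exact: cats0. Qed.

Lemma merge_merges_comm x y L : comm (merge x y) (merges L).
Proof. by apply: comm_product => p _; apply: merge_comm. Qed.

Lemma merges_absorb x y L : (x, y) \in L -> merges L ++ merge x y ≈ merges L.
Proof.
exact: (product_absorb (F := fun p => merge p.1 p.2) (fun p => mergeK _ _)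
  (fun p q => merge_comm _ _ _ _)).
Qed.

(** Along a path in the graph of [L], the identity [merge_trans] composes the
    merges. *)
Lemma merges_linked L x y : linked L x y -> merges L ++ merge x y ≈ merges L.
Proof.
case/connectP=> p + ->; elim: p x => [|z p IHp] x /=;
  first by rewrite mergexx cats0.
move=> /andP[xz /IHp zp].
have {}xz : merges L ++ merge x z ≈ merges L.
  by case/orP: xz => /merges_absorb //; rewrite merge_sym.
by rewrite -{1}xz -catA -merge_trans catA xz.
Qed.

Lemma merges_linked_sub L L' :
  (forall x y, (x, y) \in L' -> linked L x y) -> merges L ++ merges L' ≈
    merges L.
Proof.
elim: L' => [|[x y] L' IHL'] sub; first by rewrite cats0.
rewrite -[merges (_ :: _)]/(merge x y ++ merges L') catA merges_linked.
  by apply: IHL' => z t zt; apply: sub; rewrite in_cons zt orbT.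
by apply: sub; rewrite mem_head.
Qed.

Lemma eq_merges L L' : linked L =2 linked L' -> merges L ≈ merges L'.
Proof.
move=> LL'; rewrite -(merges_linked_sub (L' := L')) => [|x y]; last first.
  by rewrite LL'; apply: linked_mem.
have -> : merges L ++ merges L' ≈ merges L' ++ merges L.
  by apply: product_comm => p q; apply: merge_comm.
by apply: merges_linked_sub => x y; rewrite -LL'; apply: linked_mem.
Qed.

Lemma merges_tperm L x y : linked L x y -> merges L ++ W (tperm x y) ≈ merges L.
Proof. by move=> /merges_linked xy; rewrite -xy -catA merge_tperm. Qed.

Lemma tperm_merges L x y : linked L x y -> W (tperm x y) ++ merges L ≈ merges L.
Proof.
move=> /merges_linked xy; have c := merge_merges_comm x y L.
have := merge_perm (tperm x y) y x;
  rewrite tpermL tpermR merge_sym merge_tperm => w.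
by rewrite -xy -c catA -w.
Qed.

Lemma cuts_perm s A : cuts A ++ W s ≈ W s ++ cuts (map s A).
Proof.
elim: A => [|x A IHA]; first by rewrite /= cats0.
by rewrite -[cuts (x :: A)]/(cut x ++ cuts A) -catA IHA catA cut_perm -catA.
Qed.

Definition relabel s (L : seq ('I_n * 'I_n)) := [seq (s p.1, s p.2) | p <- L].

Lemma merges_perm s L : merges L ++ W s ≈ W s ++ merges (relabel s L).
Proof.
elim: L => [|[x y] L IHL]; first by rewrite /= cats0.
by rewrite -[merges (_ :: L)]/(merge x y ++ merges L) -catA IHL catA merge_perm
  -catA.
Qed.

(** Two cuts absorb the transposition of their points, hence [cuts A] absorbs
    every permutation supported in [A]. *)
Lemma cuts_fix s A : (forall x, x \notin A -> s x = x) -> cuts A ++ W s ≈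
  cuts A.
Proof.
apply: (perm_on_ind (A := fun x => x \in A) (Q := fun s => cuts A ++ W s ≈
  cuts A)).
  by rewrite perm_word1 cats0.
move=> x y {}s xA yA xy sA.
have xyA : cuts A ++ cut x ++ cut y ≈ cuts A by rewrite catA !cuts_absorb.
by rewrite perm_wordM catA -{1}xyA -!catA (catA (cut x))
  (catA _ (W (tperm x y))) -(catA (cut x)) cut_tperm // catA xyA.
Qed.

Lemma cuts_agree s s' A : (forall x, x \notin A -> s x = s' x) ->
  cuts A ++ W s ≈ cuts A ++ W s'.
Proof.
move=> ss'; rewrite -(mulgKV s' s) perm_wordM catA cuts_fix // => x xA.
by rewrite permM ss' // permK.
Qed.

(** Inside a merged class all merges at [x] but one can be rerouted through a
    neighbour [y] of [x], by [merge_trans]; this prepares for cutting [x]. *)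
Lemma isolate x K : exists K',
  [/\ forall p, p \in K' -> (p.1 != x) && (p.2 != x)
    & merges K ≈ merges K' \/
      exists2 y, y != x & merges K ≈ merge x y ++ merges K'].
Proof.
elim: K => [|[a b] K [K' [avoid KE]]]; first by exists [::]; split=> //; left.
have [xb|/norP[ax bx]] := boolP ((a == x) || (b == x)); last first.
  exists ((a, b) :: K'); split=> [p|].
    by rewrite in_cons => /predU1P[->|/avoid] //=; rewrite ax bx.
  rewrite -[merges (_ :: K)]/(merge a b ++ merges K)
    -[merges (_ :: K')]/(merge a b ++ merges K').
  case: KE => [E|[y yx E]]; [by left; rewrite E|right; exists y => //].
  have c := merge_comm a b x y.
  by rewrite E !catA c.
have [c abE] : exists c, merge a b ≈ merge x c.
  case/orP: xb => /eqP->; [by exists b|by exists a; rewrite merge_sym].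
have [cx|cx] := eqVneq c x.
  exists K'; split=> //; rewrite -[merges (_ :: K)]/(merge a b ++ merges K).
  by case: KE => [E|[y yx E]]; [left|right; exists y => //];
    rewrite abE cx mergexx E.
case: KE => [E|[y yx E]].
  exists K'; split=> //; right; exists c => //.
  by rewrite -[merges (_ :: K)]/(merge a b ++ merges K) abE E.
exists ((c, y) :: K'); split=> [p|].
  by rewrite in_cons => /predU1P[->|/avoid] //=; rewrite cx yx.
right; exists c => //.
rewrite -[merges (_ :: K)]/(merge a b ++ merges K) abE E.
rewrite -[merges (_ :: K')]/(merge c y ++ merges K') !catA.
by have -> := merge_trans x c y.
Qed.

(** * Normal forms *)

Definition nf L A s K := merges L ++ cuts A ++ W s ++ merges K.

Lemma cuts_merge_comm A x y : x \notin A -> y \notin A ->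
  comm (cuts A) (merge x y).
Proof.
move=> xA yA; apply/comm_sym/comm_product => z zA.
by apply: merge_cut_comm; [apply: contraNneq xA|apply: contraNneq yA] => <-.
Qed.

Lemma merge_cut_tperm x y : x != y -> merge x y ++ cut x ≈
  merge x y ++ cut y ++ W (tperm x y).
Proof.
move=> xy; have := cut_perm (tperm x y) y; rewrite tpermR => ->.
by rewrite catA merge_tperm.
Qed.

(** Cutting [y], joining it to [x] and cutting [x] transports the line of [x]
    to [y]. *)
Lemma cut_merge_cut_other x y : x != y ->
  cut y ++ merge x y ++ cut x ≈ cut y ++ W (tperm x y).
Proof.
move=> xy; rewrite merge_cut_tperm // merge_sym !catA -(catA (cut y)).
by rewrite cut_merge_cut // eq_sym.
Qed.

Lemma cuts_merge_cut A x y : x != y -> (x \in A) || (y \in A) ->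
  exists s, cuts A ++ merge x y ++ cut x ≈ cuts A ++ W s.
Proof.
move=> xy /orP[xA|yA].
  exists 1%g; have xA' := cuts_absorb xA.
  by rewrite -xA' -!catA cut_merge_cut // perm_word1 cats0.
exists (tperm x y); have yA' := cuts_absorb yA.
by rewrite -yA' -!catA cut_merge_cut_other.
Qed.

(** If [x] belongs to no merge of [K], the cut travels to the left and joins
    [A].  Otherwise one merge, with [y] say, travels along: it joins [L] when
    the preimages of [x] and [y] lie outside [A], and else it is consumed
    together with the cut, which leaves at most a transposition. *)
Lemma nf_cut L A s K x : exists L' A' s' K', nf L A s K ++ cut x ≈
  nf L' A' s' K'.
Proof.
have [K' [avoid KE]] := isolate x K.
have [a sa] : exists a, s a = x by exists ((s^-1)%g x); rewrite permKV.
have cutW := cut_perm s a; rewrite sa in cutW.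
have cK' : merges K' ++ cut x ≈ cut x ++ merges K'.
  apply/comm_sym/comm_product => p /avoid/andP[p1x p2x].
  by apply/comm_sym/merge_cut_comm; rewrite eq_sym.
case: KE => [E|[y yx E]].
  exists L, (a :: A), s, K'.
  rewrite /nf cuts_cons E -!catA cK' (catA (W s)) -cutW.
  by rewrite -!catA.
have [b sb] : exists b, s b = y by exists ((s^-1)%g y); rewrite permKV.
have ab : a != b by rewrite -(inj_eq (@perm_inj _ s)) sa sb eq_sym.
have mergeW := merge_perm s a b; rewrite sa sb in mergeW.
have {}E : nf L A s K ++ cut x ≈
  merges L ++ (cuts A ++ merge a b ++ cut a) ++ W s ++ merges K'.
  rewrite /nf E -!catA cK' (catA (W s) (merge x y)) -mergeW.
  by rewrite -catA (catA (W s)) -cutW -!catA.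
have [aA|/norP[aA bA]] := boolP ((a \in A) || (b \in A)).
  have [s' s'E] := cuts_merge_cut ab aA.
  exists L, A, (s' * s)%g, K'.
  by rewrite E s'E /nf perm_wordM -!catA.
exists (L ++ [:: (a, b)]), (a :: A), s, K'.
have c := cuts_merge_comm aA bA.
by rewrite E /nf merges_cat merges1 cuts_cons (catA (cuts A)) c -!catA.
Qed.

Lemma nf_letter L A s K a :
  exists L' A' s' K', nf L A s K ++ [:: a] ≈ nf L' A' s' K'.
Proof.
case: a => [i||].
- exists L, A, (s * transposition i)%g, (relabel (transposition i) K).
  by rewrite /nf perm_wordM -perm_word_letter -!catA merges_perm.
- have [L' [A' [s' [K' E]]]] := nf_cut L A s K p0.
  by exists L', A', s', K'; rewrite -cut_e.
- exists L, A, s, (K ++ [:: (p0, p1)]).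
  by rewrite /nf merges_cat merges1 merge_t -!catA.
Qed.

Lemma nf_word u : exists L A s K, u ≈ nf L A s K.
Proof.
elim/last_ind: u => [|u a [L [A [s [K E]]]]].
  by exists [::], [::], 1%g, [::]; rewrite /nf perm_word1.
have [L' [A' [s' [K' E']]]] := nf_letter L A s K a.
by exists L', A', s', K'; rewrite -cats1 E.
Qed.

(** The points outside [A] are those whose line survives.  Being
    representatives, they lie in different classes of [L], and so do their
    images for [K]. *)
Definition normal L (A : seq 'I_n) s K :=
  forall x, x \notin A -> rep L x = x /\ rep K (s x) = s x.

(** By [merge_cut_merge]: if two surviving lines are joined above, one of them
    may be cut provided that their lower ends are joined as well. *)
Lemma merge_spare A s x y : x \notin A -> y \notin A -> x != y ->
  merge x y ++ cuts A ++ W s ≈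
  merge x y ++ cuts (x :: A) ++ W s ++ merge (s x) (s y).
Proof.
move=> xA yA xy; have c := cuts_merge_comm xA yA.
have c' : comm (cuts A) (cut x ++ merge x y).
  by apply: comm_cat => //; apply/comm_sym/comm_product => z _; apply: cut_comm.
rewrite cuts_cons -merge_perm -(catA _ (cut x)) (catA (cut x)) (catA (cuts A))
  c'.
by rewrite -{1}(merge_cut_merge xy) -!catA.
Qed.

Lemma nf_spare_left L A s K x y : x \notin A -> y \notin A -> x != y ->
  linked L x y -> nf L A s K ≈ nf L (x :: A) s ((s x, s y) :: K).
Proof.
move=> xA yA xy /merges_linked Lxy.
transitivity (merges L ++ (merge x y ++ cuts A ++ W s) ++ merges K).
  by rewrite -!catA (catA (merges L)) Lxy.
(* the abbreviation keeps reassociation from unfolding the product *)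
rewrite merge_spare // /nf; set C := cuts (x :: A).
rewrite -[merges (_ :: K)]/(merge (s x) (s y) ++ merges K).
by rewrite -!catA (catA (merges L)) Lxy.
Qed.

Lemma nf_spare_right L A s K x y : x \notin A -> y \notin A -> x != y ->
  linked K (s x) (s y) -> nf L A s K ≈ nf (L ++ [:: (x, y)]) (x :: A) s K.
Proof.
move=> xA yA xy /merges_linked Kxy.
have {}Kxy : merge (s x) (s y) ++ merges K ≈ merges K.
  by rewrite -{2}Kxy; apply: merge_merges_comm.
have left : cuts A ++ W s ++ merge (s x) (s y) ≈ merge x y ++ cuts A ++ W s.
  have c := cuts_merge_comm xA yA.
  by rewrite -merge_perm catA c -catA.
transitivity (merges L ++ (cuts A ++ W s ++ merge (s x) (s y)) ++ merges K).
  by rewrite -!catA Kxy.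
rewrite left merge_spare // /nf merges_cat merges1; set C := cuts (x :: A).
by rewrite -!catA Kxy.
Qed.

Lemma nf_swap_left L A s K x y : linked L x y ->
  nf L A s K ≈ nf L (map (tperm x y) A) (tperm x y * s)%g K.
Proof.
move=> Lxy; have cW := cuts_perm (tperm x y) (map (tperm x y) A).
rewrite -map_comp (eq_map (tpermK x y)) map_id in cW.
rewrite /nf perm_wordM; set C := cuts (map _ A) in cW *.
by rewrite -{1}(merges_tperm Lxy) -!catA (catA C) cW -catA.
Qed.

Lemma nf_swap_right L A s K x y : linked K x y ->
  nf L A s K ≈ nf L A (s * tperm x y)%g K.
Proof. by move=> Kxy; rewrite /nf perm_wordM -{1}(tperm_merges Kxy) -!catA. Qed.

(** Let [x] be a surviving point that is not its representative [r].  If [r]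
    survives too, then [x] can be cut; if not, the merges absorb the
    transposition of [x] and [r], which makes [r] survive in place of [x].
    The lower row is treated in the same way.  The number of surviving points
    decreases in the first case; in the second it stays, and the number of
    surviving upper or lower ends that are not representatives decreases. *)
Lemma nf_normal L A s K : exists L' A' s' K',
  normal L' A' s' K' /\ nf L A s K ≈ nf L' A' s' K'.
Proof.
have [k] := ubnP #|[pred z | z \notin A]|.
elim: k L A s K => // k IHk L A s K; rewrite ltnS => Ak.
have [j] := ubnP (#|[pred z | (z \notin A) && (rep L z != z)]|
                  + #|[pred z | ((s^-1)%g z \notin A) && (rep K z != z)]|).
elim: j A s Ak => // j IHj A s Ak; rewrite ltnS => Aj.
have [/existsP[x /andP[xA rx]]|/existsPn okL] :=
    boolP [exists x, (x \notin A) && (rep L x != x)].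
  have Lx := rep_linked L x; have rr := rep_idem L x.
  have [rA|rA] := boolP (rep L x \in A); last first.
    have [|L' [A' [s' [K' [N E]]]]] :=
      IHk L (x :: A) s ((s x, s (rep L x)) :: K).
      by apply: leq_trans (card_notin_cons xA) Ak.
    exists L', A', s', K'; split=> //; rewrite -E.
    by apply: nf_spare_left => //; rewrite eq_sym.
  set r := rep L x in rx Lx rr rA.
  have memA z : (z \in map (tperm x r) A) = (tperm x r z \in A).
    by rewrite -{1}(tpermK x r z) mem_map //; apply: perm_inj.
  have [||L' [A' [s' [K' [N E]]]]] := IHj (map (tperm x r) A) (tperm x r * s)%g.
  - apply: leq_trans Ak;
    rewrite -[X in _ <= X]cardsE -(card_preimset _ (@perm_inj _ (tperm x r))).
    by apply/subset_leq_card/subsetP=> z; rewrite !inE memA.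
  - apply: leq_trans Aj; rewrite -addSn leq_add //; last first.
      apply/subset_leq_card/subsetP=> z; rewrite !inE memA.
      by rewrite invMg permM permKV.
    apply: proper_card; apply/properP; split; last first.
      by exists x; rewrite !inE ?xA ?rx // memA tpermL rA.
    apply/subsetP=> z; rewrite !inE memA.
    by case: tpermP => [->|->|_ _]; rewrite ?rA // rr eqxx andbF.
  exists L', A', s', K'; split=> //; rewrite -E; exact: nf_swap_left.
have [/existsP[x /andP[xA rx]]|/existsPn okK] :=
    boolP [exists x, (x \notin A) && (rep K (s x) != s x)].
  have Kx := rep_linked K (s x); have rr := rep_idem K (s x).
  set r := rep K (s x) in rx Kx rr.
  have [rA|rA] := boolP ((s^-1)%g r \in A); last first.
    have [|L' [A' [s' [K' [N E]]]]] :=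
      IHk (L ++ [:: (x, (s^-1)%g r)]) (x :: A) s K.
      by apply: leq_trans (card_notin_cons xA) Ak.
    exists L', A', s', K'; split=> //; rewrite -E.
    apply: nf_spare_right => //; rewrite ?permKV //.
    by apply: contraNneq rx => xr; rewrite xr permKV.
  have [||L' [A' [s' [K' [N E]]]]] := IHj A (s * tperm (s x) r)%g.
  - by [].
  - apply: leq_trans Aj; rewrite -addnS leq_add //.
    apply: proper_card; apply/properP; split; last first.
      exists (s x); rewrite !inE; first by rewrite permK xA rx.
      by rewrite invMg permM tpermV tpermL rA.
    apply/subsetP=> z; rewrite !inE invMg permM tpermV.
    by case: tpermP => [->|->|_ _]; rewrite ?(negPf rA) ?rA // rr eqxx andbF.
  exists L', A', s', K'; split=> //; rewrite -E; exact: nf_swap_right.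
exists L, A, s, K; split=> // x xA.
by have := okL x; have := okK x; rewrite xA /= !negbK => /eqP -> /eqP ->.
Qed.

(** * Normal forms are determined by their colourings *)

Implicit Types f g h : {ffun 'I_n -> bool}.

Lemma run_cat u v f g : run hn (u ++ v) f g <->
  exists2 h, run hn u f h & run hn v h g.
Proof.
rewrite run_compatible /Phi free_hom_cat compatibleM.
by split=> -[h fh hg]; exists h; apply/run_compatible.
Qed.

Lemma run_cong u v f g : u ≈ v -> run hn u f g <-> run hn v f g.
Proof. by move/(cong_sound hn)/Phi_eq. Qed.

Lemma run_perm s f g : run hn (W s) f g <-> move s f = g.
Proof.
rewrite /perm_word; have /eqP {3}<- := xchooseP (adjacent_perms_surj s).
exact: run_adjacent_words.
Qed.

Lemma run_conj s u f g : run hn (conj s u) f g <->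
  run hn u (move s^-1 f) (move s^-1 g).
Proof.
rewrite run_cat; split=> [[h1 /run_perm <- /run_cat[h2 h12 /run_perm <-]]|H].
  by rewrite moveM mulgV move1.
exists (move s^-1 f); first exact/run_perm.
apply/run_cat; exists (move s^-1 g) => //; apply/run_perm.
by rewrite moveM mulVg move1.
Qed.

Lemma run_cut x f g : run hn (cut x) f g <-> forall y, y != x -> f y = g y.
Proof.
have [s <-] := perm_map1 x; rewrite (run_cong _ _ (cut_conj s)) run_conj /=.
split=> [[c /ffunP fg] y ys|fg].
  have := fg ((s^-1)%g y); rewrite !ffunE invgK permKV; case: eqP => // sy.
  by rewrite -sy permKV eqxx in ys.
exists (g (s p0)); apply/ffunP=> y; rewrite !ffunE invgK;
  case: eqP => [->//|/eqP yp].
by apply: fg; rewrite (inj_eq (@perm_inj _ s)).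
Qed.

Lemma run_merge x y f g : run hn (merge x y) f g <-> f x = f y /\ f = g.
Proof.
have [<-|/perm_map2[s [<- <-]]] := eqVneq x y.
  by rewrite mergexx /=; split=> [|[]].
rewrite (run_cong _ _ (merge_conj s)) run_conj /= !ffunE !invgK.
split=> [] [E fg]; split=> //; last by rewrite fg.
by have := congr1 (move s) fg; rewrite !moveM mulVg !move1.
Qed.

Lemma run_merges L f g :
  run hn (merges L) f g <-> (forall p, p \in L -> f p.1 = f p.2) /\ f = g.
Proof.
elim: L f => [|[x y] L IHL] f; first by split=> [|[]] //.
rewrite run_cat; split=> [[h /run_merge[fxy <-] /IHL[fL fg]]|[fL fg]].
  by split=> // p; rewrite in_cons => /predU1P[->|/fL].
exists f; first by apply/run_merge; split=> //; apply: (fL (x, y));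
  rewrite mem_head.
by apply/IHL; split=> // p pL; apply: fL; rewrite in_cons pL orbT.
Qed.

Lemma run_cuts A f g :
  run hn (cuts A) f g <-> (forall x, x \notin A -> f x = g x).
Proof.
elim: A f => [|x A IHA] f; first by split=> [-> //|fg]; apply/ffunP=> x;
  apply: fg.
rewrite run_cat; split=> [[h /run_cut fh /IHA hg] y|fg].
  by rewrite in_cons negb_or => /andP[yx yA]; rewrite fh // hg.
exists (update x (g x) f); first by apply/run_cut=> y /negPf yx;
  rewrite ffunE yx.
apply/IHA=> y yA; rewrite ffunE; case: eqP => [->//|/eqP yx].
by apply: fg; rewrite in_cons negb_or yx.
Qed.

Lemma run_nf L A s K f g : run hn (nf L A s K) f g <->
  [/\ forall p, p \in L -> f p.1 = f p.2, forall p, p \in K -> g p.1 = g p.2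
    & forall x, x \notin A -> f x = g (s x)].
Proof.
rewrite !run_cat; split.
  move=> [f' /run_merges[fL <-]
    /run_cat[h /run_cuts fh /run_cat[g' /run_perm <- /run_merges[gK <-]]]].
  by split=> // x xA; rewrite ffunE permK fh.
case=> fL gK fg; exists f; first exact/run_merges.
apply/run_cat; exists (move s^-1 g).
  by apply/run_cuts=> x xA; rewrite ffunE invgK fg.
apply/run_cat; exists g; last exact/run_merges.
by apply/run_perm; rewrite moveM mulVg move1.
Qed.

(* Colouring exactly one block is compatible with a normal form, whether the
   block is transversal, upper or lower.  Hence an equality of colours that
   holds for all compatible colourings comes from a common block. *)

Section Normal.
Variables (L K : seq ('I_n * 'I_n)) (A : seq 'I_n) (s : 'S_n).
Hypothesis N : normal L A s K.

Let lclass x : {ffun 'I_n -> bool} := [ffun y => linked L x y].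
Let rclass x : {ffun 'I_n -> bool} := [ffun y => linked K x y].
Let none : {ffun 'I_n -> bool} := [ffun=> false].

Let class_const M x p : p \in M -> linked M x p.1 = linked M x p.2.
Proof.
case: p => y z /linked_mem yz.
exact: (same_connect_r (sym_connect_sym (edge_sym M)) yz).
Qed.

Lemma run_through c : c \notin A ->
  run hn (nf L A s K) (lclass c) (rclass (s c)).
Proof.
move=> cA; apply/run_nf; split=> [p pL|p pK|x xA]; rewrite !ffunE.
- exact: class_const.
- exact: class_const.
have [rc rsc] := N cA; have [rx rsx] := N xA.
apply/idP/idP => /linked_rep.
  by rewrite rc rx => ->; apply: connect0.
by rewrite rsc rsx => /perm_inj ->; apply: connect0.
Qed.

Lemma run_left a : (forall x, x \notin A -> ~~ linked L a x) ->
  run hn (nf L A s K) (lclass a) none.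
Proof.
move=> aA; apply/run_nf; split=> [p pL|p pK|x xA]; rewrite !ffunE //.
  exact: class_const.
by apply/negbTE/aA.
Qed.

Lemma run_right b : (forall x, x \notin A -> ~~ linked K b (s x)) ->
  run hn (nf L A s K) none (rclass b).
Proof.
move=> bA; apply/run_nf; split=> [p pL|p pK|x xA]; rewrite !ffunE //.
  exact: class_const.
by apply/esym/negbTE/bA.
Qed.

Lemma forced_left x y : (forall f g, run hn (nf L A s K) f g -> f x = f y) ->
  linked L x y.
Proof.
move=> H; have [/existsP[c /andP[cA xc]]|/existsPn nc] :=
    boolP [exists c, (c \notin A) && linked L x c].
  have := H _ _ (run_through cA);
    rewrite !ffunE [linked L c x]linked_sym xc => /esym cy.
  exact: connect_trans xc cy.
have := H (lclass x) none; rewrite !ffunE {1}/linked connect0 => <- //.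
by apply: run_left => c cA; have := nc c; rewrite cA.
Qed.

Lemma forced_right x y : (forall f g, run hn (nf L A s K) f g -> g x = g y) ->
  linked K x y.
Proof.
move=> H; have [/existsP[c /andP[cA xc]]|/existsPn nc] :=
    boolP [exists c, (c \notin A) && linked K x (s c)].
  have := H _ _ (run_through cA);
    rewrite !ffunE [linked K (s c) x]linked_sym xc => /esym cy.
  exact: connect_trans xc cy.
have := H none (rclass x); rewrite !ffunE {1}/linked connect0 => <- //.
by apply: run_right => c cA; have := nc c; rewrite cA.
Qed.

Lemma forced_through x y : rep L x = x -> rep K y = y ->
  (forall f g, run hn (nf L A s K) f g -> f x = g y) -> x \notin A /\ s x = y.
Proof.
move=> rx ry H; have [/existsP[c /andP[cA xc]]|/existsPn nc] :=
    boolP [exists c, (c \notin A) && linked L x c].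
  have [rc rsc] := N cA.
  have E : x = c by rewrite -rx -rc; apply: linked_rep.
  rewrite E; split=> //.
  have := H _ _ (run_through cA);
    rewrite !ffunE E {1}/linked connect0 => /esym/linked_rep.
  by rewrite rsc ry.
have := H (lclass x) none; rewrite !ffunE {1}/linked connect0 => T.
by suff /T : run hn (nf L A s K) (lclass x) none by []; apply: run_left => c cA;
  have := nc c; rewrite cA.
Qed.
End Normal.

Lemma nf_unique L A s K L' A' s' K' :
  normal L A s K -> normal L' A' s' K' ->
  (forall f g, run hn (nf L A s K) f g <-> run hn (nf L' A' s' K') f g) ->
  nf L A s K ≈ nf L' A' s' K'.
Proof.
move=> N N' NN'.
have LL' : linked L =2 linked L'.
  move=> x y; apply/idP/idP=> xy.
    by apply: (forced_left N') => f g /NN'/run_nf[fL _ _]; apply: linked_eq xy.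
  by apply: (forced_left N) => f g /NN'/run_nf[fL _ _]; apply: linked_eq xy.
have KK' : linked K =2 linked K'.
  move=> x y; apply/idP/idP=> xy.
    by apply: (forced_right N') => f g /NN'/run_nf[_ gK _]; apply: linked_eq xy.
  by apply: (forced_right N) => f g /NN'/run_nf[_ gK _]; apply: linked_eq xy.
have AA' x : x \notin A -> x \notin A' /\ s' x = s x.
  move=> xA; have [rx rsx] := N _ xA.
  apply: (forced_through N'); rewrite -?(eq_rep LL') -?(eq_rep KK') //.
  by move=> f g /NN'/run_nf[_ _]; apply.
have A'A x : x \notin A' -> x \notin A.
  move=> xA; have [rx rsx] := N' _ xA.
  have [] // := forced_through N (x := x) (y := s' x).
  - by rewrite (eq_rep LL').
  - by rewrite (eq_rep KK').
  - by move=> f g /NN'/run_nf[_ _]; apply.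
rewrite /nf (eq_merges LL') (eq_merges KK').
have EA : cuts A ≈ cuts A'.
  by apply: eq_cuts => x; apply: negb_inj; apply/idP/idP => [/AA'[]|/A'A].
rewrite EA (catA (cuts A')) (@cuts_agree s s') -?catA // => x /A'A/AA'[_ ->] //.
Qed.

(** * The presentation *)

Lemma Phi_complete u v : Phi hn u = Phi hn v -> u ≈ v.
Proof.
move=> uv.
have normal_word w : exists L A s K, normal L A s K /\ w ≈ nf L A s K.
  have [L [A [s [K wE]]]] := nf_word w.
  have [L' [A' [s' [K' [N E]]]]] := nf_normal L A s K.
  by exists L', A', s', K'; split=> //; rewrite wE.
have [L [A [s [K [N uE]]]]] := normal_word u.
have [L' [A' [s' [K' [N' vE]]]]] := normal_word v.
rewrite uE vE; apply: nf_unique => // f g.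
by rewrite -(run_cong _ _ uE) -(run_cong _ _ vE); move: f g; apply/Phi_eq.
Qed.

Lemma Phi_surjective (a : partition_monoid n) : exists w, Phi hn w = a.
Proof.
(* in each transversal block, one line joins a chosen upper point to a chosen
   lower point *)
pose up (r : vertex n) := [pick x | same a r (inl x)].
pose low (r : vertex n) := [pick y | same a r (inr y)].
have same_eq1 r r' : same a r r' -> same a r =1 same a r'.
  move=> rr' r2; apply/idP/idP; apply: same_trans => //.
  by rewrite same_sym.
have up_eq r r' : same a r r' -> up r = up r' by move=> rr';
  apply: eq_pick => x; apply: same_eq1.
have low_eq r r' : same a r r' -> low r = low r' by move=> rr';
  apply: eq_pick => x; apply: same_eq1.
pose L := [seq p <- enum {: 'I_n * 'I_n} | same a (inl p.1) (inl p.2)].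
pose K := [seq p <- enum {: 'I_n * 'I_n} | same a (inr p.1) (inr p.2)].
pose xs := [seq x <- enum 'I_n | (up (inl x) == Some x) &&
  (low (inl x) != None)].
pose lowd x := odflt x (low (inl x)).
have xsP x : x \in xs -> up (inl x) = Some x /\ same a (inl x) (inr (lowd x)).
  rewrite mem_filter /lowd => /andP[/andP[/eqP-> +] _].
  by rewrite /low; case: pickP.
have uxs : uniq xs by apply/filter_uniq/enum_uniq.
have uys : uniq (map lowd xs).
  rewrite map_inj_in_uniq // => x y /xsP[ux xl] /xsP[uy yl] E.
  have xy : same a (inl x) (inl y).
    by apply: same_trans xl _; rewrite E same_sym.
  by have := up_eq _ _ xy; rewrite ux uy => -[].
have [s sE] : exists s : 'S_n, map s xs = map lowd xs.
  by apply: perm_extend; rewrite ?size_map.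
pose A := [seq x <- enum 'I_n | x \notin xs].
have sxs x : x \in xs -> s x = lowd x.
  by move=> xxs; apply: (iffRL (eq_in_map s lowd xs) sE).
exists (nf L A s K); apply: compatible_inj => f g.
rewrite -run_compatible run_nf compatibleP; split.
  case=> fL gK fg.
  have thr x y : same a (inl x) (inr y) -> f x = g y.
    move=> xy.
    have [x0 x0E] : exists x0, up (inl x) = Some x0.
      by rewrite /up; case: pickP => [x0 _|/(_ x)];
        [exists x0|rewrite same_refl].
    have xx0 : same a (inl x) (inl x0).
      by move: x0E; rewrite /up; case: pickP => // ? ? [<-].
    have x0xs : x0 \in xs.
      rewrite mem_filter mem_enum andbT -(up_eq _ _ xx0) x0E eqxx /=.
      rewrite -(low_eq _ _ xx0) /low; case: pickP => // /(_ y).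
      by rewrite xy.
    have [_ x0low] := xsP _ x0xs.
    have -> : f x = f x0 by apply: (fL (x, x0));
      rewrite mem_filter xx0 mem_enum.
    have x0A : x0 \notin A by rewrite mem_filter x0xs.
    rewrite (fg _ x0A) (sxs _ x0xs); apply: (gK (lowd x0, y)).
    rewrite mem_filter mem_enum andbT /=; apply: same_trans xy.
    by rewrite same_sym; apply: same_trans xx0 x0low.
  move=> [x|x] [y|y] xy /=.
  - by apply: (fL (x, y)); rewrite mem_filter xy mem_enum.
  - exact: thr.
  - by apply/esym/thr; rewrite same_sym.
  - by apply: (gK (x, y)); rewrite mem_filter xy mem_enum.
move=> fg; split=> [p|p|x].
- by rewrite mem_filter => /andP[/fg].
- by rewrite mem_filter => /andP[/fg].
- rewrite mem_filter mem_enum andbT negbK => xxs.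
  by rewrite sxs //; have [_ /fg] := xsP _ xxs.
Qed.
End PermutationWords.

Theorem theorem2p2 (n : nat) (hn : 2 <= n) :
  has_presentation_via (@R n) (Phi hn).
Proof.
split=> [a|u v]; first exact: Phi_surjective.
by split=> [/Phi_complete|/(cong_sound hn)].
Qed.
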